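(* Let $p\in(2,\infty)$ with $1/p+1/q=1$, let $n\ge2$ be an integer and $\epsilon\in(0,1)$. There exist universal constants $\delta_0,\delta_2,\delta_3>0$ such that, with $N=\lceil\delta_3n^{\delta_2}((\frac12+\frac1q)n\ln n+\ln\frac1\epsilon)\rceil$, the random set $\mathbb H^n_3(\epsilon)=\{\boldsymbol z_1,\dots,\boldsymbol z_N\}$ of i.i.d. vectors evenly distributed on $\mathbb S^n_p$ satisfies $$\mathrm{Prob}\Big\{\mathbb H^n_3(\epsilon)\in\mathbb T^n_p\Big(\sqrt{\tfrac{\delta_0\ln n}{2n}},N\Big)\Big\}\ge1-\epsilon.$$
   Context: $\mathbb S^n_p=\{\boldsymbol x\in\mathbb R^n:\|\boldsymbol x\|_p=1\}$. A random vector is evenly distributed on $\mathbb S^n_p$ if it equals $\boldsymbol y/\|\boldsymbol y\|_p$ where the entries of $\boldsymbol y$ are i.i.d. with density $pe^{-|x|^p}/\int_0^\infty2t^{(1-p)/p}e^{-t}dt$. $\mathbb T^n_p(\tau,m)$ is the family of sets $\mathbb H\subseteq\mathbb S^n_p$ with $|\mathbb H|\le m$ such that every $\boldsymbol x\in\mathbb S^n_q$ has some $\boldsymbol v\in\mathbb H$ with $\boldsymbol x^{\mathrm T}\boldsymbol v\ge\tau$. *)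

(* Defs.v *)
From HB Require Import structures.
From mathcomp Require Import all_boot all_order all_algebra.
From mathcomp Require Import all_classical all_reals all_analysis.
Set Implicit Arguments. Unset Strict Implicit. Unset Printing Implicit Defensive.
Import Order.TTheory GRing.Theory Num.Theory.
Local Open Scope classical_set_scope.
Local Open Scope ring_scope.

Section Defs.
Variable R : realType.

Definition lpnorm (p : R) (n : nat) (x : 'rV[R]_n) : R :=
  (\sum_(i < n) `|x 0 i| `^ p) `^ (p^-1).

Definition lpsphere (p : R) (n : nat) : set 'rV[R]_n :=
  [set x | lpnorm p x = 1].

Definition dotv (n : nat) (x v : 'rV[R]_n) : R := \sum_(i < n) x 0 i * v 0 i.

(* T^n_p(tau, m): sets H of at most m points of S^n_p such that every
   x in S^n_q has some v in H with x^T v >= tau.  (q is the dual exponent.) *)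
Definition Tfamily (p q : R) (n : nat) (tau : R) (m : nat)
    (H : set 'rV[R]_n) : Prop :=
  [/\ H `<=` @lpsphere p n,
      (H #<= [set k : nat | (k < m)%N])%card &
      forall x, @lpsphere q n x -> exists2 v, H v & tau <= dotv x v].

Definition gen_gauss_const (p : R) : R :=
  fine (\int[lebesgue_measure]_(t in `[0%R, +oo[)
          ((2 * t `^ ((1 - p) / p) * expR (- t))%:E))%E.

Definition gen_gauss_density (p : R) (x : R) : R :=
  p * expR (- (`|x| `^ p)) / gen_gauss_const p.

Definition has_density d (T : measurableType d) (P : probability T R)
    (X : T -> R) (f : R -> R) : Prop :=
  forall A : set R, measurable A ->
    P (X @^-1` A) = (\int[lebesgue_measure]_(x in A) (f x)%:E)%E.

Definition mutually_independent d (T : measurableType d) (P : probability T R)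
    (I : finType) (X : I -> T -> R) : Prop :=
  forall A : I -> set R, (forall i, measurable (A i)) ->
    P (\bigcap_(i in [set: I]) (X i @^-1` A i)) =
    (\prod_(i : I) P (X i @^-1` A i))%E.

Definition lpnormalize (p : R) (n : nat) (y : 'rV[R]_n) : 'rV[R]_n :=
  (lpnorm p y)^-1 *: y.

End Defs.

(* Main.v *)
(** Fix x with ||x||_q >= 1 and let S = sum_i x_i y_i, where the y_i have density
    c exp(-|y|^p). The moment generating function of y_i satisfies, with constants
    independent of p, c1 psi(m) <= ln E exp(m y_i) and ln E exp(2 m y_i) <= C1 psi(m), where
    psi(m) = min(m^2, |m|^q). Choosing l with sum_i psi(l x_i) of order
    ln n, the Paley-Zygmund inequality for exp(l S) shows that S >= ln n / l with
    probability polynomially small in 1/n but not smaller, while a Chernoff bound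
    gives ||y||_p = O(n^(1/p)) outside an exponentially small event. Since l is at
    most of order (ln n)^(1/2) n^(1/2 - 1/p), a normalised row has inner product of order
    sqrt(ln n / n) with x with probability at least n^(-A) / 8. A union bound over
    a grid of mesh 1/(D n^2) then covers the whole q-sphere. Grid points are
    rounded away from zero, so that their q-norm stays at least 1. *)

Require Import Defs.
From HB Require Import structures.
From mathcomp Require Import all_boot all_order all_algebra.
From mathcomp Require Import all_classical all_reals all_analysis.
From mathcomp Require Import measurable_realfun ring lra.
Import Order.TTheory GRing.Theory Num.Theory.
Import numFieldNormedType.Exports.

Set Implicit Arguments. Unset Strict Implicit. Unset Printing Implicit Defensive.

Local Open Scope classical_set_scope.
Local Open Scope ring_scope.

Import HBNNSimple.

(** Every constant must be uniform in p over the unbounded range p > 2, so the density is never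
    integrated exactly. The inequality y^2 - 1 <= |y|^p dominates it by a Gaussian; together with
    the mass of [0, 1] this confines the normalising factor c between e / [gaussK] and e. In psi,
    the square is the variance regime of small m, and |m|^q is the Legendre dual of |y|^p, which
    governs large m. No fixed scale l serves every x: spread-out mass puts l x_i in the square
    regime, concentrated mass in the power regime. Hence l is chosen from x, and only its upper
    bound is uniform. Two formal obstacles shape the rest. The covering property quantifies over
    uncountably many x, so its measurability comes from an equivalent family of conditions on grids
    of all meshes. And independence is assumed for single entries, while the argument needs it for
    whole rows and for expectations of products; both extensions free one index at a time. *)

(** * Integrals of a function of a random variable against a weight *)

Section integral_comp_weight.
Local Open Scope ereal_scope.
Context d d' (T : measurableType d) (E : measurableType d') (R : realType).

Lemma integral_nnsfun_comp_weight (mu : {measure set T -> \bar R}) (X : T -> E)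
    (W : T -> R) (h : {nnsfun E >-> R}) :
  measurable_fun setT X -> measurable_fun setT W -> (forall x, (0 <= W x)%R) ->
  \int[mu]_x (h (X x) * W x)%:E =
  \sum_(k \in range h)
    k%:E * \int[mu]_(x in X @^-1` (h @^-1` [set k])) (W x)%:E.
Proof.
move=> mX mW W0.
have mA k : measurable (X @^-1` (h @^-1` [set k])).
  by rewrite -[X @^-1` _]setTI; exact: mX.
have m1 k : measurable_fun setT
    (fun x => (k * \1_(h @^-1` [set k]) (X x) * W x)%:E).
  apply/measurable_EFinP; apply: measurable_funM => //.
  apply: measurable_funM => //.
  have mi : measurable_fun setT (\1_(h @^-1` [set k]) : E -> R).
    exact: measurable_indic.
  exact: (measurableT_comp mi mX).
transitivity (\int[mu]_x
    (\sum_(k \in range h) (k * \1_(h @^-1` [set k]) (X x) * W x)%:E)).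
  apply: eq_integral => x _.
  by rewrite fsumEFin// {1}fimfunE mulr_fsuml.
rewrite ge0_integral_fsum//; last first.
  move=> k x _; rewrite lee_fin mulr_ge0//.
  by have := nnfun_muleindic_ge0 h k (X x); rewrite -EFinM lee_fin.
apply: eq_fsbigr => k /[!inE] -[y _ <-].
rewrite -[RHS]ge0_integralZl//; last 3 first.
- exact/measurable_funTS/measurable_EFinP.
- by move=> x _; rewrite lee_fin.
- by rewrite lee_fin.
rewrite [RHS]integral_mkcond; apply: eq_integral => x _.
rewrite patchE indicE.
rewrite (_ : (x \in _) = (X x \in h @^-1` [set h y])) ?mem_preimage//.
by case: (_ \in _); rewrite /= ?mulr1// mulr0 mul0r.
Qed.

Lemma integral_comp_weight_lim (mu : {measure set T -> \bar R}) (X : T -> E)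
    (W : T -> R) (g : E -> \bar R) (mg : measurable_fun setT g) :
  measurable_fun setT X -> measurable_fun setT W -> (forall x, (0 <= W x)%R) ->
  (forall y, 0 <= g y) ->
  \int[mu]_x (g (X x) * (W x)%:E) =
  limn (fun n => \int[mu]_x (nnsfun_approx measurableT mg n (X x) * W x)%:E).
Proof.
move=> mX mW W0 g0; rewrite -monotone_convergence//.
- apply: eq_integral => x _; apply/esym/cvg_lim => //=.
  under eq_fun do rewrite EFinM.
  by apply: cvgeZr => //; apply: cvg_nnsfun_approx.
- move=> n; apply/measurable_EFinP; apply: measurable_funM => //.
  have mh : measurable_fun setT (nnsfun_approx measurableT mg n) by [].
  exact: (measurableT_comp mh mX).
- by move=> n x _; rewrite lee_fin mulr_ge0.
- move=> x _ m n mn; rewrite lee_fin ler_wpM2r//.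
  exact/lefP/nd_nnsfun_approx.
Qed.

End integral_comp_weight.

(** By monotone convergence simple functions suffice, and for these only the weighted measures of
    level sets enter. It serves independence, where the weight is the product of the remaining
    factors, and densities, where one weight is the density. *)
Lemma eq_integral_comp_weight d1 d2 d' (T1 : measurableType d1)
    (T2 : measurableType d2) (E : measurableType d') (R : realType)
    (mu1 : {measure set T1 -> \bar R}) (mu2 : {measure set T2 -> \bar R})
    (X1 : T1 -> E) (X2 : T2 -> E) (W1 : T1 -> R) (W2 : T2 -> R) (g : E -> \bar R) :
  measurable_fun setT X1 -> measurable_fun setT X2 ->
  measurable_fun setT W1 -> measurable_fun setT W2 ->
  (forall x, 0 <= W1 x) -> (forall x, 0 <= W2 x) ->
  measurable_fun setT g -> (forall y, 0 <= g y)%E ->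
  (forall A, measurable A ->
    \int[mu1]_(x in X1 @^-1` A) (W1 x)%:E =
    \int[mu2]_(x in X2 @^-1` A) (W2 x)%:E)%E ->
  (\int[mu1]_x (g (X1 x) * (W1 x)%:E) = \int[mu2]_x (g (X2 x) * (W2 x)%:E))%E.
Proof.
move=> mX1 mX2 mW1 mW2 W10 W20 mg g0 H.
rewrite !(integral_comp_weight_lim _ mg)//; congr (limn _); apply/funext => n.
rewrite !integral_nnsfun_comp_weight//; apply: eq_fsbigr => k _.
by rewrite H.
Qed.

(** * Independence: expectations of products, generated sigma-algebras, rows *)

(** Induction on the list of indices at which [h] may be arbitrary; elsewhere [h] is an indicator.
    With indicators everywhere the claim is the independence hypothesis itself. *)
Lemma integral_indep_prod d (T : measurableType d) (R : realType)
    (P : probability T R) (I : finType) (X : I -> T -> R) (h : I -> R -> R) :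
  (forall i, measurable_fun setT (X i)) ->
  mutually_independent P X ->
  (forall i, measurable_fun setT (h i)) -> (forall i y, 0 <= h i y) ->
  (forall i, \int[P]_w (h i (X i w))%:E < +oo)%E ->
  (\int[P]_w (\prod_i h i (X i w))%:E =
   (\prod_i fine (\int[P]_w (h i (X i w))%:E))%:E)%E.
Proof.
move=> mX indX.
have : forall i, i \notin enum I -> exists2 A, measurable A & h i = \1_A.
  by move=> i; rewrite mem_enum.
elim: (enum I) h => [|j s IH] h hs mh h0 hfin.
  have {hs}/choice[A] : forall i, exists A, measurable A /\ h i = \1_A.
    by move=> i; have [//|A mA hA] := hs i; exists A.
  move=> /all_and2[mA hA].
  have hE i w : h i (X i w) = \1_(X i @^-1` A i) w by rewrite hA !indicE.
  have mXA i : measurable (X i @^-1` A i) by rewrite -[_ @^-1` _]setTI; exact: mX.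
  rewrite -prodEFin; transitivity (P (\bigcap_(i in [set: I]) (X i @^-1` A i))).
    transitivity (\int[P]_w (\1_(\bigcap_(i in [set: I]) (X i @^-1` A i)) w)%:E)%E.
      apply: eq_integral => w _; congr _%:E.
      under eq_bigr do rewrite hE.
      rewrite indicE; case: (boolP (w \in _)) => [/set_mem wA|/negP wA].
        by rewrite big1// => i _; rewrite indicE mem_set//; exact: wA.
      have [i wAi] : exists i, ~ (X i @^-1` A i) w.
        by apply/existsNP => wA'; apply: wA; apply/mem_set => i _; exact: wA'.
      by rewrite (bigD1 i)//= indicE memNset// mul0r.
    rewrite integral_indic ?setIT//.
    by apply: fin_bigcap_measurable => [|i _]; [exact: finite_finset|exact: mXA].
  rewrite indX//; apply: eq_bigr => i _.
  rewrite fineK; last by rewrite ge0_fin_numE// integral_ge0// => w _; rewrite lee_fin.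
  by under eq_integral do rewrite hE; rewrite integral_indic ?setIT.
pose c := \prod_(i | i != j) fine (\int[P]_w (h i (X i w))%:E)%E.
have c0 : 0 <= c.
  by apply: prodr_ge0 => i _; apply: fine_ge0; apply: integral_ge0 => w _; rewrite lee_fin.
have mhX (i : I) : measurable_fun setT (fun w => h i (X i w)).
  exact: measurableT_comp (mh i) (mX i).
(* The product of the other factors is a weight, compared with the constant [c]: over an event about
   [X j] both integrate alike, by the induction hypothesis with [h j] replaced by an indicator. *)
have := @eq_integral_comp_weight _ _ _ T T R R P P (X j) (X j)
  (fun w => \prod_(i | i != j) h i (X i w)) (cst c) (EFin \o h j)
  (mX j) (mX j).
move=> /(_ _ _ _ _ _ _ _)/wrap[].
- under eq_fun do rewrite -big_filter; apply: measurable_prod => i _.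
  exact: mhX.
- exact: measurable_cst.
- by move=> w; apply: prodr_ge0.
- by move=> w.
- exact/measurable_EFinP.
- by move=> y; rewrite lee_fin.
- move=> A mA; have mXA : measurable (X j @^-1` A).
    by rewrite -[_ @^-1` _]setTI; exact: mX.
  pose h' := fun i => if i == j then \1_A else h i.
  have mh' i : measurable_fun setT (h' i).
    by rewrite /h'; case: ifP => // _; exact: measurable_indic.
  have iA : (\int[P]_w (\1_A (X j w))%:E)%E = P (X j @^-1` A).
    transitivity (\int[P]_w (\1_(X j @^-1` A) w)%:E)%E.
      by apply: eq_integral => w _; rewrite !indicE.
    by rewrite integral_indic ?setIT.
  have /(_ _ _ _ _)/wrap[] := IH h'.
  + move=> i is'; rewrite /h'; case: eqP => [_|/eqP ij]; first by exists A.
    by apply: hs; rewrite inE negb_or ij.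
  + exact: mh'.
  + by move=> i y; rewrite /h'; case: ifP.
  + move=> i; rewrite /h'; case: eqP => [->|_]; last exact: hfin.
    by rewrite iA (le_lt_trans (probability_le1 P mXA)) ?ltry.
  rewrite (bigD1 j)//= {2}/h' eqxx iA.
  rewrite (eq_bigr (fun i => fine (\int[P]_w (h i (X i w))%:E)%E)); last first.
    by move=> i ij; rewrite /h' (negbTE ij).
  rewrite -/c => E.
  rewrite integral_cst// muleC -[X in (X * _)%E]fineK ?fin_num_measure// -EFinM -E.
  rewrite [LHS]integral_mkcond; apply: eq_integral => w _.
  rewrite patchE [in RHS](bigD1 j)//= {1}/h' eqxx indicE.
  rewrite (_ : (w \in _) = (X j w \in A)) ?mem_preimage//.
  case: ifP => _; rewrite ?mul0r// mul1r; congr _%:E.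
  by apply: eq_bigr => i ij; rewrite /h' (negbTE ij).
move=> E.
rewrite (bigD1 j)//= -/c EFinM fineK; last first.
  by rewrite ge0_fin_numE// integral_ge0// => w _; rewrite lee_fin.
rewrite -ge0_integralZr//; last 2 first.
- exact/measurable_EFinP.
- by move=> w _; rewrite lee_fin.
rewrite -[RHS]E; apply: eq_integral => w _.
by rewrite (bigD1 j)//= -EFinM.
Qed.

(** Dynkin argument, one index at a time: with the other sets fixed, both sides are finite measures
    in the set at [j] that agree on the pi-system [G]. *)
Lemma indep_g_sigma_algebra d (T : measurableType d) (R : realType)
    (P : probability T R) d' (E : measurableType d') (G : set (set E))
    (J : finType) (X : J -> T -> E) :
  measurable = <<s G >> :> set (set E) -> setI_closed G -> G setT ->
  (forall j, measurable_fun setT (X j)) ->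
  (forall B : J -> set E, (forall j, G (B j)) ->
    P (\bigcap_(j in [set: J]) (X j @^-1` B j)) = \prod_j P (X j @^-1` B j))%E ->
  forall B : J -> set E, (forall j, measurable (B j)) ->
    (P (\bigcap_(j in [set: J]) (X j @^-1` B j)) = \prod_j P (X j @^-1` B j))%E.
Proof.
move=> mG GI GT mX indG B.
have : forall j, j \notin enum J -> G (B j) by move=> j; rewrite mem_enum.
elim: (enum J) B => [|j s IH] B Bs mB; first by apply: indG => j; exact: Bs.
have mXB (k : J) A : measurable A -> measurable (X k @^-1` A).
  by move=> mA; rewrite -[_ @^-1` _]setTI; exact: mX.
pose C := \bigcap_(k in [set k | k != j]) (X k @^-1` B k).
have mC : measurable C.
  by apply: fin_bigcap_measurable => [|i _]; [exact: finite_finset|exact/mXB].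
have c0 : (0 <= \prod_(k | k != j) P (X k @^-1` B k))%E by exact: prode_ge0.
pose c : {nonneg R} := NngNum (fine_ge0 c0).
have cE : (c%:num%:E = \prod_(k | k != j) P (X k @^-1` B k))%E.
  by rewrite /= fineK// prode_fin_num// => k _; rewrite fin_num_measure//; exact: mXB.
pose Xj : {mfun T >-> E} := HB.pack (X j) (isMeasurableFun.Build _ _ _ _ _ (mX j)).
have capE A : (\bigcap_(k in [set: J]) (X k @^-1` (if k == j then A else B k))) =
    X j @^-1` A `&` C.
  apply/seteqP; split => w.
    move=> H; split; first by have := H j I; rewrite eqxx.
    by move=> k /= kj; have := H k I; rewrite (negbTE kj).
  by move=> [wA wC] k _; case: eqP => [->//|/eqP]; exact: wC.
have prodE A : (\prod_k P (X k @^-1` (if k == j then A else B k)) =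
    P (X j @^-1` A) * c%:num%:E)%E.
  rewrite cE (bigD1 j)//= eqxx; congr (_ * _)%E.
  by apply: eq_bigr => k kj; rewrite (negbTE kj).
have E1 : B = (fun k => if k == j then B j else B k).
  by apply/funext => k; case: eqP => [->|].
rewrite E1 capE prodE muleC.
apply: (measure_unique G (fun=> setT) mG GI _ _ (pushforward (mrestr P mC) Xj)
  (mscale c (pushforward P Xj))) => //.
- by rewrite bigcup_const//; exists 0%N.
- move=> A GA; rewrite /mscale/= /mrestr /mscale /pushforward/= muleC -prodE -capE.
  apply: IH => k.
    by move=> ks; case: ifP => // kj; apply: Bs; rewrite inE negb_or kj.
  by case: ifP => // _; rewrite mG; exact: sub_sigma_algebra.
- move=> _; rewrite /= /mrestr /pushforward.
  by rewrite (le_lt_trans (probability_le1 P _)) ?ltry// preimage_setT setTI.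
Qed.

Lemma mutually_independent_row d (T : measurableType d) (R : realType)
    (P : probability T R) (J I : finType) (Y : J -> I -> T -> R) (j : J) :
  mutually_independent P (fun ji : J * I => Y ji.1 ji.2) ->
  mutually_independent P (Y j).
Proof.
move=> ind A mA.
have := ind (fun ki => if ki.1 == j then A ki.2 else setT).
move=> /(_ _)/wrap[ki|]; first by case: ifP.
rewrite (_ : (\bigcap_(i in _) _) = \bigcap_(i in [set: I]) (Y j i @^-1` A i)).
  move=> ->; rewrite -(pair_bigA _ (fun k i =>
    P (Y k i @^-1` (if k == j then A i else setT)))) /= (bigD1 j)//=.
  rewrite [X in (_ * X)%E]big1 ?mule1; first by apply: eq_bigr => i _; rewrite eqxx.
  move=> k /negbTE kj; apply: big1 => i _; rewrite kj preimage_setT.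
  exact: probability_setT.
apply/seteqP; split => w /=.
  by move=> H i _; have /= := H (j, i) Logic.I; rewrite eqxx.
by move=> H [k i] _ /=; case: eqP => // ->; exact: H.
Qed.

Section row_independence.
Context d (T : measurableType d) (R : realType) (I : finType).

Definition rectangles : set (set (I -> R)) :=
  [set B | exists2 A : I -> set R, (forall i, measurable (A i)) &
     B = [set f | forall i, A i (f i)]].

(* [I -> R] with its product sigma-algebra. *)
Definition vecI : Type := g_sigma_algebraType rectangles.

HB.instance Definition _ := Measurable.on vecI.

Lemma measurable_coord (i : I) : measurable_fun setT (fun f : vecI => f i : R).
Proof.
move=> _ A mA; rewrite setTI; apply: sub_sigma_algebra.
exists (fun k => if k == i then A else setT).
  by move=> k; case: ifP.
apply/seteqP; split => f /=; first by move=> fA k; case: eqP => // ->.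
by move=> /(_ i); rewrite eqxx.
Qed.

Lemma measurable_tovec (Y : I -> T -> R) :
  (forall i, measurable_fun setT (Y i)) ->
  measurable_fun setT (fun w => (fun i => Y i w) : vecI).
Proof.
move=> mY;
have := @measurability _ _ T vecI setT (fun w => (fun i => Y i w) : vecI)
  rectangles; apply => //.
move=> _ [_ [A mA ->] <-]; rewrite setTI.
rewrite (_ : _ @^-1` _ = \bigcap_(i in [set: I]) (Y i @^-1` A i)).
  apply: fin_bigcap_measurable => [|i _]; first exact: finite_finset.
  by rewrite -[_ @^-1` _]setTI; exact: mY.
by apply/seteqP; split => w /= H i; [move=> _|]; exact: H.
Qed.

(** The events applied later are joint conditions on a row, not rectangles. On rectangles the claim
    is a regrouping of the product over pairs; these form a pi-system generating [vecI]. *)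
Lemma indep_rows (P : probability T R) (J : finType) (Y : J -> I -> T -> R)
    (B : J -> set vecI) :
  (forall j i, measurable_fun setT (Y j i)) ->
  mutually_independent P (fun ji : J * I => Y ji.1 ji.2) ->
  (forall j, measurable (B j)) ->
  (P (\bigcap_(j in [set: J]) [set w | B j (fun i => Y j i w)]) =
   \prod_j P [set w | B j (fun i => Y j i w)])%E.
Proof.
move=> mY ind.
pose X j w : vecI := fun i => Y j i w.
have H := @indep_g_sigma_algebra _ T R P _ vecI rectangles J X; apply: H => //.
- move=> _ _ [A mA ->] [A' mA' ->]; exists (fun i => A i `&` A' i).
    by move=> i; exact: measurableI.
  by apply/seteqP; split => f /= => [[H1 H2] i|H]; split => // i; have [] := H i.
- by exists (fun=> setT) => //; apply/seteqP; split.
- by move=> j; exact: measurable_tovec.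
move=> {}B GB.
have /choice[A] : forall j, exists A : I -> set R,
    (forall i, measurable (A i)) /\ B j = [set f | forall i, A i (f i)].
  by move=> j; have [A ? ?] := GB j; exists A.
move=> /all_and2[mA BE].
have rowE j : (P (X j @^-1` B j) = \prod_i P (Y j i @^-1` A j i))%E.
  rewrite -(mutually_independent_row j ind)//; congr (P _).
  rewrite BE; apply/seteqP; split => w /=; first by move=> H i _; exact: H.
  by move=> H i; exact: H.
under eq_bigr do rewrite rowE.
rewrite pair_bigA -(ind (fun ki => A ki.1 ki.2))//.
congr (P _); apply/seteqP; split => w /=.
  by move=> H [j i] _ /=; have := H j Logic.I; rewrite BE /=; exact.
by move=> H j _; rewrite BE => i; exact: (H (j, i)).
Qed.

End row_independence.

(** * Elementary inequalities *)

Section elementary.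
Context {R : realType}.
Implicit Types x y z t : R.

(** With a = exp(z/2) and b = exp(-z/2), ab = 1 gives cosh z = 1 + (a - b)^2 / 2, and a - b >= z/2
    for z >= 0. *)
Lemma cosh_ge z : 1 + z ^+ 2 / 8 <= (expR z + expR (- z)) / 2.
Proof.
wlog z0 : z / 0 <= z.
  move=> H; have [z0|z0] := leP 0 z; first exact: H.
  by have := H (- z); rewrite opprK sqrrN (addrC (expR (- z))); apply; rewrite oppr_ge0 ltW.
have e1 := expR_ge1Dx (z / 2).
have e2 : expR (- (z / 2)) <= 1 by rewrite -[leRHS]expR0 ler_expR; lra.
have -> : expR z = expR (z / 2) ^+ 2 by rewrite expr2 -expRD; congr expR; lra.
have -> : expR (- z) = expR (- (z / 2)) ^+ 2 by rewrite expr2 -expRD; congr expR; lra.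
have := expRxMexpNx_1 (z / 2).
by move: (expR (z / 2)) (expR (- _)) e1 e2 => a b; nra.
Qed.

(** The identity cosh z = 1 + (a - b)^2 / 2 again, with a - b <= 2z for 0 <= z <= 1; beyond 1, z <=
    2 z^2 suffices. *)
Lemma cosh_le z : (expR z + expR (- z)) / 2 <= expR (2 * z ^+ 2).
Proof.
wlog z0 : z / 0 <= z.
  move=> H; have [z0|z0] := leP 0 z; first exact: H.
  by have := H (- z); rewrite opprK sqrrN (addrC (expR (- z))); apply; rewrite oppr_ge0 ltW.
have [z1|z1] := leP z 1; last first.
  have a1 : expR z <= expR (2 * z ^+ 2) by rewrite ler_expR; nra.
  have a2 : expR (- z) <= expR (2 * z ^+ 2) by rewrite ler_expR; nra.
  lra.
apply: le_trans (expR_ge1Dx _).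
have e1 := expR_ge1Dx (- (z / 2)).
have -> : expR z = expR (z / 2) ^+ 2 by rewrite expr2 -expRD; congr expR; lra.
have -> : expR (- z) = expR (- (z / 2)) ^+ 2 by rewrite expr2 -expRD; congr expR; lra.
have := expRxMexpNx_1 (z / 2); have := expR_ge0 (z / 2); have := expR_ge1Dx (z / 2).
move: (expR (z / 2)) (expR (- _)) e1 => a b e1 a1 a0 ab.
have ba : a - b <= 2 * z by nra.
have : (a - b) ^+ 2 <= (2 * z) ^+ 2 by rewrite ler_sqr ?nnegrE; nra.
nra.
Qed.

Lemma expR_convex01 t x : 0 <= t <= 1 -> expR (t * x) <= 1 - t + t * expR x.
Proof.
move=> /andP[t0 t1]; set u := t * x.
have -> : expR x = expR u * expR (x - u) by rewrite -expRD addrCA subrr addr0.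
have e1 := expR_ge1Dx (x - u).
have e2 : 1 = expR u * expR (- u) by rewrite expRxMexpNx_1.
have e3 := expR_ge1Dx (- u).
have := expR_gt0 u; move: (expR u) (expR (x - u)) (expR (- u)) e1 e2 e3.
move=> a b c e1 e2 e3 a0.
have : a * ((1 - t) * (1 - u) + t * (1 + x - u)) <= a * ((1 - t) * c + t * b).
  by rewrite ler_pM2l//; apply: lerD; apply: ler_wpM2l => //; lra.
by rewrite (_ : _ * (1 - u) + _ = 1) /u; [nra|ring].
Qed.

(** Turns a lower bound 1 + t on a moment into an exponential one, with little loss while t stays
    bounded. *)
Lemma expR_le1D t : 0 <= t -> expR (t / (1 + t)) <= 1 + t.
Proof.
move=> t0; have p : 0 < 1 + t by lra.
have := expR_ge1Dx (- (t / (1 + t))).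
rewrite (_ : 1 - _ = (1 + t)^-1); last by field; lra.
by rewrite expRN lef_pV2 ?posrE ?expR_gt0.
Qed.

Lemma expR_ge2x x : 0 <= x -> 2 * x <= expR x.
Proof.
move=> x0; have -> : expR x = expR (x / 2) ^+ 2 by rewrite expr2 -expRD; congr expR; lra.
have := expR_ge1Dx (x / 2); move: (expR _) => a ax.
have := sqr_ge0 (1 - x / 2); have : 0 <= (a - (1 + x / 2)) * (a + (1 + x / 2)).
  by apply: mulr_ge0; lra.
lra.
Qed.

(** Source of the uniformity in p: subtracting 1 covers |y| < 1 and costs only a factor e in the
    density. *)
Lemma powR_ge_sqr (p : R) y : 2 <= p -> y ^+ 2 - 1 <= `|y| `^ p.
Proof.
move=> p2; have [y1|y1] := leP 1 `|y|.
  have := ler_powR y1 p2; rewrite powR_mulrn// real_normK ?num_real//. lra.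
have := powR_ge0 `|y| p; have : `|y| ^+ 2 <= 1 by have := normr_ge0 y; nra.
rewrite real_normK ?num_real//. lra.
Qed.

Lemma conjugate_bounds (p q : R) : 2 < p -> p^-1 + q^-1 = 1 -> 1 < q < 2.
Proof.
move=> p2 pq.
have p1 : 0 < p^-1 < 2^-1.
  by rewrite invr_gt0 ltf_pV2 ?posrE; lra.
have q1 : q^-1 = 1 - p^-1 by lra.
have q0 : 0 < q by rewrite -invr_gt0; lra.
by rewrite -ltf_pV2 ?posrE// -[X in _ && X]ltf_pV2 ?posrE// invr1; lra.
Qed.

End elementary.

(** * Gaussian domination of the density, uniformly in p *)

Section gaussian_domination.
Context {R : realType}.
Local Notation mu := (@lebesgue_measure R).

(** [(normal_peak 1)^-1] is the integral of exp(-y^2/2). One factor e covers c <= e, the other the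
    loss in [powR_ge_sqr]; the summand 1 makes [gaussK_ge1] immediate. *)
Definition gaussK : R := 1 + expR 2 * (normal_peak 1)^-1.

Local Notation S := (normal_peak (1 : R))^-1.

Let S_gt0 : 0 < S.
Proof. by rewrite invr_gt0 normal_peak_gt0// oner_eq0. Qed.

Let gaussK_geS : expR 2 * S <= gaussK.
Proof. by rewrite /gaussK lerDr. Qed.

Lemma gaussK_ge1 : 1 <= gaussK.
Proof. by rewrite /gaussK lerDl mulr_ge0 ?expR_ge0// invr_ge0 normal_peak_ge0. Qed.

Lemma integral_le_gauss (K : R) (g : R -> R) : measurable_fun setT g ->
  (forall y, 0 <= g y) -> (forall y, g y <= K * expR (- (y ^+ 2 / 2))) ->
  (\int[mu]_y (g y)%:E <= (K * S)%:E)%E.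
Proof.
move=> mg g0 gK.
have K0 : 0 <= K.
  have := gK 0; rewrite expr0n mul0r oppr0 expR0 mulr1; exact: le_trans.
rewrite -[leRHS]mule1 -(integral_normal_pdf 0 1) -ge0_integralZl_EFin//; last 3 first.
- by move=> y _; rewrite lee_fin; exact: normal_pdf_ge0.
- by apply/measurable_EFinP; exact: measurable_normal_pdf.
- by rewrite mulr_ge0// ltW.
apply: ge0_le_integral => //.
- by move=> y _; rewrite lee_fin.
- exact/measurable_EFinP.
- apply/measurable_EFinP; apply: measurable_funM => //.
  exact: measurable_normal_pdf.
- move=> y _; rewrite lee_fin normal_pdfE ?oner_eq0//.
  rewrite mulrA -(mulrA K) mulVf ?gt_eqF ?normal_peak_gt0 ?oner_eq0//.
  by rewrite mulr1 /normal_fun subr0 expr1n mulNr.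
Qed.

Lemma ge0_integral_oppr (g : R -> \bar R) : measurable_fun setT g ->
  (forall y, 0 <= g y)%E -> (\int[mu]_y g (- y)%R = \int[mu]_y g y)%E.
Proof.
move=> mg g0.
rewrite -[in LHS](preimage_setT (-%R : R -> measurableTypeR R)).
rewrite -[LHS]/(\int[mu]_(y in (-%R : _ -> measurableTypeR R) @^-1` setT) (g \o -%R) y)%E.
rewrite -ge0_integral_pushforward//=.
by apply: eq_measure_integral => //= A mA _; exact: lebesgue_measureN.
Qed.

Section generalized_gaussian.
Variables (p c : R).
Hypothesis p2 : 2 < p.

(** The factor [c] stays a variable: its sign and size are derived from total mass 1 alone, so the
    normalising integral is never evaluated. *)
Definition ggd (y : R) : R := c * expR (- (`|y| `^ p)).

Hypothesis int_ggd : (\int[mu]_y (ggd y)%:E = 1)%E.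

Lemma measurable_norm_powR : measurable_fun setT (fun y : R => `|y| `^ p).
Proof.
by apply: (measurableT_comp (measurable_powR p)); exact: normr_measurable.
Qed.

Lemma measurable_ggd : measurable_fun setT ggd.
Proof.
apply: measurable_funM => //; apply: measurableT_comp => //.
apply: measurableT_comp => //; exact: measurable_norm_powR.
Qed.

Lemma ggd_const_gt0 : 0 < c.
Proof.
rewrite ltNge; apply/negP => c0.
have : (\int[mu]_y (ggd y)%:E <= 0)%E.
  have g0 y : [set: R] y -> (0 <= (- ggd y)%:E)%E.
    by rewrite lee_fin oppr_ge0 mulr_le0_ge0// expR_ge0.
  under eq_integral do rewrite -[_%:E]oppeK -[in X in (- X)%E]EFinN.
  by rewrite integral_ge0N// oppe_le0 integral_ge0.
by rewrite int_ggd lee_fin ler10.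
Qed.

Lemma ggd_ge0 y : 0 <= ggd y.
Proof. by rewrite mulr_ge0 ?expR_ge0// ltW// ggd_const_gt0. Qed.

(** On [0, 1] the density is at least c / e, and that interval has mass at most 1. *)
Lemma ggd_const_le : c <= expR 1.
Proof.
have p0 : 0 <= p by have := p2; lra.
have c0 := ggd_const_gt0.
have : (\int[mu]_(y in `[0%R, 1%R]) (c * expR (- 1))%:E <= 1)%E.
  rewrite -int_ggd.
  apply: (@le_trans _ _ (\int[mu]_(y in `[0%R, 1%R]) (ggd y)%:E)%E).
    apply: ge0_le_integral => //.
    - by move=> y _; rewrite lee_fin mulr_ge0 ?expR_ge0// ltW.
    - by apply/measurable_EFinP; apply: measurable_funTS; exact: measurable_ggd.
    - move=> y /=; rewrite in_itv/= => /andP[y0 y1].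
      rewrite lee_fin ler_pM2l// ler_expR lerN2 ger0_norm//.
      have -> : 1 = 1 `^ p :> R by rewrite powR1.
      by apply: ge0_ler_powR; rewrite ?nnegrE.
  apply: ge0_subset_integral => //.
  - by apply/measurable_EFinP; exact: measurable_ggd.
  - by move=> y _; rewrite lee_fin ggd_ge0.
rewrite integral_cst//= lebesgue_measure_itv/= lte_fin ltr01 oppr0 adde0 mule1.
by rewrite lee_fin expRN ler_pdivrMr ?expR_gt0// mul1r.
Qed.

Lemma ggd_le y : ggd y <= c * expR 1 * expR (- (y ^+ 2)).
Proof.
rewrite -mulrA -expRD ler_pM2l ?ggd_const_gt0// ler_expR.
have := @powR_ge_sqr _ p y (ltW p2); lra.
Qed.

Lemma ggd_const_ge : expR 1 <= c * gaussK.
Proof.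
have c0 := ggd_const_gt0.
have : (\int[mu]_y (ggd y)%:E <= (c * expR 1 * S)%:E)%E.
  apply: integral_le_gauss; [exact: measurable_ggd|exact: ggd_ge0|move=> y].
  apply: (le_trans (ggd_le y)); rewrite ler_pM2l ?mulr_gt0 ?expR_gt0//.
  by rewrite ler_expR; have := sqr_ge0 y; lra.
rewrite int_ggd lee_fin => H.
apply: (@le_trans _ _ (c * (expR 2 * S))); last by rewrite ler_pM2l.
rewrite (_ : 2 = 1 + 1) ?expRD; last by ring.
have -> : c * (expR 1 * expR 1 * S) = expR 1 * (c * expR 1 * S) by ring.
by rewrite ler_pMr ?expR_gt0.
Qed.

Lemma ggd_moment_sqr :
  (\int[mu]_y (expR (y ^+ 2 / 2) * ggd y)%:E <= gaussK%:E)%E.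
Proof.
have c0 := ggd_const_gt0.
apply: (@le_trans _ _ (c * expR 1 * S)%:E).
  apply: integral_le_gauss.
  - apply: measurable_funM => //; last exact: measurable_ggd.
    by apply: measurableT_comp => //; apply: measurable_funM => //; exact: exprn_measurable.
  - by move=> y; rewrite mulr_ge0 ?expR_ge0 ?ggd_ge0.
  - move=> y; apply: (@le_trans _ _ (expR (y ^+ 2 / 2) * (c * expR 1 * expR (- y ^+ 2)))).
      by rewrite ler_pM2l ?expR_gt0// ggd_le.
    rewrite mulrCA -expRD ler_pM2l ?mulr_gt0 ?expR_gt0// ler_expR; lra.
rewrite lee_fin; apply: le_trans gaussK_geS.
rewrite ler_pM2r// (_ : 2 = 1 + 1) ?expRD; last by ring.
by rewrite ler_pM2r ?expR_gt0// ggd_const_le.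
Qed.

Lemma ggd_moment_powR :
  (\int[mu]_y (expR (`|y| `^ p / 2) * ggd y)%:E <= gaussK%:E)%E.
Proof.
have c0 := ggd_const_gt0.
apply: (@le_trans _ _ (c * expR 1 * S)%:E).
  apply: integral_le_gauss.
  - apply: measurable_funM => //; last exact: measurable_ggd.
    apply: measurableT_comp => //; apply: measurable_funM => //.
    exact: measurable_norm_powR.
  - by move=> y; rewrite mulr_ge0 ?expR_ge0 ?ggd_ge0.
  - move=> y; rewrite /ggd mulrCA -expRD -mulrA -expRD ler_pM2l// ler_expR.
    have := @powR_ge_sqr _ p y (ltW p2); lra.
rewrite lee_fin; apply: le_trans gaussK_geS.
rewrite ler_pM2r// (_ : 2 = 1 + 1) ?expRD; last by ring.
by rewrite ler_pM2r ?expR_gt0// ggd_const_le.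
Qed.

Definition mgf (m : R) : \bar R := (\int[mu]_y (expR (m * y) * ggd y)%:E)%E.

Lemma measurable_expRM m : measurable_fun setT (fun y : R => expR (m * y)).
Proof. by apply: measurableT_comp => //; exact: measurable_funM. Qed.

Lemma mgfN m : mgf (- m) = mgf m.
Proof.
rewrite /mgf -[RHS]ge0_integral_oppr.
- by apply: eq_integral => y _; rewrite /ggd mulNr mulrN normrN.
- apply/measurable_EFinP; apply: measurable_funM; last exact: measurable_ggd.
  exact: measurable_expRM.
- by move=> y; rewrite lee_fin mulr_ge0 ?expR_ge0 ?ggd_ge0.
Qed.

(** Symmetrisation removes the term linear in m, which allows comparison with 1 + O(m^2). *)
Lemma mgf_cosh m :
  mgf m = (\int[mu]_y ((expR (m * y) + expR (- (m * y))) / 2 * ggd y)%:E)%E.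
Proof.
have h k : (\int[mu]_y (2^-1 * (expR (k * y) * ggd y))%:E = 2^-1%:E * mgf k)%E.
  rewrite -ge0_integralZl_EFin//.
  - by move=> y _; rewrite lee_fin mulr_ge0 ?expR_ge0 ?ggd_ge0.
  - apply/measurable_EFinP; apply: measurable_funM; last exact: measurable_ggd.
    exact: measurable_expRM.
have : (2^-1%:E * mgf m + 2^-1%:E * mgf (- m) = mgf m)%E.
  rewrite mgfN -ge0_muleDl ?lee_fin// -EFinD (_ : 2^-1 + 2^-1 = 1) ?mul1e//; lra.
rewrite -!h -ge0_integralD//; first last.
- apply/measurable_EFinP; apply: measurable_funM => //.
  by apply: measurable_funM; [exact: measurable_expRM|exact: measurable_ggd].
- by move=> y _; rewrite lee_fin mulr_ge0// mulr_ge0 ?expR_ge0 ?ggd_ge0.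
- apply/measurable_EFinP; apply: measurable_funM => //.
  by apply: measurable_funM; [exact: measurable_expRM|exact: measurable_ggd].
- by move=> y _; rewrite lee_fin mulr_ge0// mulr_ge0 ?expR_ge0 ?ggd_ge0.
move=> <-; apply: eq_integral => y _; rewrite -EFinD mulNr; congr _%:E.
by field.
Qed.

End generalized_gaussian.
End gaussian_domination.

(** * Upper bound on the moment generating function *)

Section mgf_bounds.
Context {R : realType}.
Local Notation mu := (@lebesgue_measure R).
Implicit Types p q c m : R.

Definition psi q m : R := Num.min (`|m| ^+ 2) (`|m| `^ q).

Lemma psi_ge0 q m : 0 <= psi q m.
Proof. by rewrite /psi le_min exprn_ge0//= powR_ge0. Qed.

Lemma mgf_norm p c m : 2 < p -> (\int[mu]_y (ggd p c y)%:E = 1)%E ->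
  mgf p c `|m| = mgf p c m.
Proof.
move=> p2 f1; have [m0|m0] := leP 0 m; first by rewrite ger0_norm.
by rewrite ltr0_norm// mgfN.
Qed.

Lemma powR_le_sqr q m : q <= 2 -> 1 <= m -> m `^ q <= m ^+ 2.
Proof.
by move=> q2 m1; rewrite -powR_mulrn ?(le_trans ler01)//; exact: ler_powR.
Qed.

Lemma sqr_le_powR q m : q <= 2 -> 0 < m <= 1 -> m ^+ 2 <= m `^ q.
Proof.
move=> q2 /andP[m0 m1]; rewrite -powR_mulrn ?(ltW m0)//.
by apply: ger_powR => //; rewrite m0.
Qed.

Lemma mgf_le p q c m : 2 < p -> p^-1 + q^-1 = 1 ->
  (\int[mu]_y (ggd p c y)%:E = 1)%E ->
  (mgf p c (2 * m) <= (expR (64 * (1 + gaussK) * psi q m))%:E)%E.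
Proof.
move=> p2 pq f1; have /andP[q1 q2] := conjugate_bounds p2 pq.
wlog m0 : m / 0 <= m.
  move=> H; have := H `|m| (normr_ge0 _).
  by rewrite /psi normr_id -[2 in X in (X <= _)%E]normr_nat -normrM mgf_norm.
have K1 := @gaussK_ge1 R.
have g0 := ggd_ge0 f1.
have mg := @measurable_ggd R p c.
have [m4|m4] := leP m 4^-1.
  rewrite mgf_cosh//.
  (* [cosh_le] at 2my has exponent 8 m^2 y^2 = 16 m^2 * (y^2/2). The threshold m <= 1/4 makes 16 m^2
     an admissible convex weight between 1 and exp(y^2/2). *)
  have th : 0 <= 16 * m ^+ 2 <= 1.
    by rewrite mulr_ge0 ?exprn_ge0//=; nra.
  have psiE : psi q m = m ^+ 2.
    rewrite /psi ger0_norm//; have [->|mn0] := eqVneq m 0.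
      by rewrite expr0n/= min_l// powR_ge0.
    by rewrite min_l// sqr_le_powR ?ltW//; lra.
  have mexp2 : measurable_fun setT (fun y : R => expR (y ^+ 2 / 2)).
    apply: measurableT_comp => //; apply: measurable_funM => //.
  apply: (@le_trans _ _ (\int[mu]_y ((1 - 16 * m ^+ 2) * ggd p c y +
      16 * m ^+ 2 * (expR (y ^+ 2 / 2) * ggd p c y))%:E)%E).
    apply: ge0_le_integral => //.
    - move=> y _; rewrite lee_fin mulr_ge0 ?g0// mulr_ge0// addr_ge0 ?expR_ge0//.
    - apply/measurable_EFinP; apply: measurable_funM => //.
      apply: measurable_funM => //; apply: measurable_funD.
        exact: measurable_expRM.
      under eq_fun do rewrite -mulNr; exact: measurable_expRM.
    - apply/measurable_EFinP; apply: measurable_funD; apply: measurable_funM => //.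
      exact: measurable_funM.
    - move=> y _; rewrite lee_fin mulrA -mulrDl ler_wpM2r//.
      apply: (le_trans (cosh_le _)).
      rewrite (_ : 2 * _ = 16 * m ^+ 2 * (y ^+ 2 / 2)); last by field.
      exact: expR_convex01.
  under eq_integral do rewrite EFinD.
  rewrite ge0_integralD//; last 4 first.
  - by move=> y _; rewrite lee_fin mulr_ge0//; lra.
  - by apply/measurable_EFinP; exact: measurable_funM.
  - by move=> y _; rewrite lee_fin mulr_ge0//; [lra|rewrite mulr_ge0 ?expR_ge0].
  - by apply/measurable_EFinP; apply: measurable_funM => //; exact: measurable_funM.
  under eq_integral do rewrite EFinM.
  under [X in (_ + X)%E]eq_integral do rewrite EFinM.
  rewrite !ge0_integralZl_EFin//; last 6 first.
  - by move=> y _; rewrite lee_fin mulr_ge0 ?expR_ge0.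
  - by apply/measurable_EFinP; exact: measurable_funM.
  - lra.
  - by move=> y _; rewrite lee_fin.
  - exact/measurable_EFinP.
  - lra.
  rewrite f1 mule1; apply: (@le_trans _ _ (1 - 16 * m ^+ 2 + 16 * m ^+ 2 * gaussK)%:E).
    rewrite [leRHS]EFinD leeD2l// [leRHS]EFinM lee_wpmul2l ?lee_fin//; first lra.
    exact: ggd_moment_sqr.
  rewrite lee_fin psiE; apply: le_trans (expR_ge1Dx _).
  nra.
(* Young's inequality for |y| and 4m, halved; 4^q <= 16 gives the 8. *)
have Y0 y : 2 * m * y <= `|y| `^ p / 2 + 8 * m `^ q.
  have := @conjugate_powR R `|y| (4 * m) p q (normr_ge0 _) _ _ _ pq.
  move=> /(_ _ _ _)/wrap[]; [lra|lra|lra|].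
  have e1 : (4 * m) `^ q <= 16 * m `^ q.
    rewrite powRM//.
    apply: ler_wpM2r; first exact: powR_ge0.
    by rewrite (le_trans (powR_le_sqr _ _))//; lra.
  have e2 : `|y| `^ p / p <= `|y| `^ p.
    rewrite ler_pdivrMr; last lra.
    by rewrite ler_peMr ?powR_ge0//; lra.
  have e3 : (4 * m) `^ q / q <= (4 * m) `^ q.
    rewrite ler_pdivrMr; last lra.
    by rewrite ler_peMr ?powR_ge0//; lra.
  have : m * y <= m * `|y| by rewrite ler_wpM2l ?ler_norm.
  lra.
have mq0 : 0 <= m `^ q := powR_ge0 _ _.
have psi1 : m `^ q <= 4 * psi q m.
  rewrite /psi ger0_norm//; have [m1|m1] := leP 1 m.
    by rewrite min_r ?powR_le_sqr//; lra.
  have mp : 0 < m by lra.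
  have := @ger_powR _ m _ _ _ (ltW q1).
  rewrite mp (ltW m1) powRr1// => /(_ isT) h.
  rewrite min_l ?sqr_le_powR ?mp ?(ltW m1) ?(ltW q2)//; nra.
have psi2 : 16^-1 <= m `^ q.
  have [m1|m1] := leP 1 m.
    have := @ler_powR _ m m1 0 q; rewrite powRr0 => /(_ (ltW (lt_trans ltr01 q1))).
    lra.
  have mp : 0 < m by lra.
  have := @sqr_le_powR q m (ltW q2); rewrite mp (ltW m1) => /(_ isT).
  nra.
apply: (@le_trans _ _ (expR (8 * m `^ q) * gaussK)%:E).
  rewrite [leRHS]EFinM.
  apply: (@le_trans _ _ ((expR (8 * m `^ q))%:E *
      \int[mu]_y (expR (`|y| `^ p / 2) * ggd p c y)%:E)%E); last first.
    by rewrite lee_wpmul2l ?lee_fin ?expR_ge0// ggd_moment_powR.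
  have mexpp : measurable_fun setT (fun y : R => expR (`|y| `^ p / 2)).
    apply: measurableT_comp => //; apply: measurable_funM => //.
    exact: measurable_norm_powR.
  rewrite -ge0_integralZl_EFin ?expR_ge0//; last 2 first.
  - by move=> y _; rewrite lee_fin mulr_ge0 ?expR_ge0.
  - by apply/measurable_EFinP; exact: measurable_funM.
  apply: ge0_le_integral => //.
  - by move=> y _; rewrite lee_fin mulr_ge0 ?expR_ge0.
  - apply/measurable_EFinP; apply: measurable_funM => //; exact: measurable_expRM.
  - apply/measurable_EFinP; apply: measurable_funM => //; exact: measurable_funM.
  - move=> y _; rewrite -EFinM lee_fin [leRHS]mulrA -expRD ler_wpM2r// ler_expR addrC; exact: Y0.
(* In this regime psi >= 1/64, so 64 * gaussK * psi absorbs the prefactor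
   [gaussK <= expR gaussK]. *)
rewrite lee_fin (le_trans (ler_wpM2l (expR_ge0 _) (_ : _ <= expR gaussK)))//.
  by have := expR_ge1Dx (@gaussK R); lra.
rewrite -expRD ler_expR; nra.
Qed.

End mgf_bounds.

(** * Lower bound on the moment generating function *)

Section mgf_lower_bound.
Context {R : realType}.
Local Notation mu := (@lebesgue_measure R).
Implicit Types p q c m : R.

(** The interval [1/2, 1] suffices: there y^2 >= 1/4 and the density is at least c / e >= 1 /
    [gaussK]. *)
Lemma ggd_second_moment p c : 2 < p -> (\int[mu]_y (ggd p c y)%:E = 1)%E ->
  ((8 * gaussK)^-1%:E <= \int[mu]_y (y ^+ 2 * ggd p c y)%:E)%E.
Proof.
move=> p2 f1; have c0 := ggd_const_gt0 f1; have g0 := ggd_ge0 f1.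
have cK := ggd_const_ge p2 f1; have K1 := @gaussK_ge1 R.
have mg := @measurable_ggd R p c.
have p0 : 0 <= p by lra.
have m2 : measurable_fun setT (fun y : R => y ^+ 2 * ggd p c y).
  exact: measurable_funM.
apply: (@le_trans _ _
    (\int[mu]_(y in `[(2^-1)%R, 1%R]) (4^-1 * (c * expR (- 1)))%:E)%E).
  rewrite integral_cst//= lebesgue_measure_itv/= lte_fin (_ : 2^-1 < 1); last lra.
  rewrite -EFinD -EFinM lee_fin invfM.
  have : gaussK^-1 <= c * expR (- 1).
    rewrite expRN ler_pdivlMr ?expR_gt0// ler_pdivrMl; lra.
  by move: (_ * expR _) => a; lra.
apply: (@le_trans _ (\bar R) (\int[mu]_(y in `[(2^-1)%R, 1%R]) (y ^+ 2 * ggd p c y)%:E)%E).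
  apply: ge0_le_integral => //.
  - by move=> y _; rewrite lee_fin !mulr_ge0 ?expR_ge0// ltW.
  - by apply/measurable_EFinP; apply: measurable_funTS.
  - move=> y /=; rewrite in_itv/= => /andP[y0 y1].
    have y00 : 0 <= y by rewrite (le_trans _ y0)// invr_ge0.
    rewrite lee_fin; apply: ler_pM.
    + by rewrite invr_ge0.
    + by rewrite mulr_ge0 ?expR_ge0// ltW.
    + rewrite (_ : 4^-1 = 2^-1 ^+ 2); last by field.
      by rewrite ler_sqr ?nnegrE ?invr_ge0.
    + rewrite ler_pM2l// ler_expR lerN2 ger0_norm//.
      have -> : 1 = 1 `^ p :> R by rewrite powR1.
      by apply: ge0_ler_powR; rewrite ?nnegrE.
apply: ge0_subset_integral => //.
- exact/measurable_EFinP.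
- by move=> y _; rewrite lee_fin mulr_ge0 ?sqr_ge0.
Qed.

Lemma mgf_ge_sqr p c m : 2 < p -> (\int[mu]_y (ggd p c y)%:E = 1)%E ->
  ((1 + m ^+ 2 / (64 * gaussK))%:E <= mgf p c m)%E.
Proof.
move=> p2 f1; have g0 := ggd_ge0 f1; have K1 := @gaussK_ge1 R.
have mg := @measurable_ggd R p c.
have m2 : measurable_fun setT (fun y : R => y ^+ 2 * ggd p c y).
  exact: measurable_funM.
rewrite mgf_cosh//.
apply: (@le_trans _ (\bar R) (\int[mu]_y (ggd p c y + m ^+ 2 / 8 * (y ^+ 2 * ggd p c y))%:E)%E).
  under eq_integral do rewrite EFinD.
  have k0 : 0 <= m ^+ 2 / 8 by rewrite mulr_ge0 ?sqr_ge0.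
  rewrite ge0_integralD//; last 4 first.
  - by move=> y _; rewrite lee_fin.
  - exact/measurable_EFinP.
  - by move=> y _; rewrite lee_fin mulr_ge0// mulr_ge0 ?sqr_ge0.
  - by apply/measurable_EFinP; exact: measurable_funM.
  under [X in (_ <= _ + X)%E]eq_integral do rewrite EFinM.
  rewrite ge0_integralZl_EFin//; last 2 first.
  - by move=> y _; rewrite lee_fin mulr_ge0 ?sqr_ge0.
  - exact/measurable_EFinP.
  rewrite f1 EFinD leeD2l//.
  apply: (@le_trans _ _ ((m ^+ 2 / 8)%:E * (8 * gaussK)^-1%:E)%E).
    rewrite -EFinM lee_fin le_eqVlt; apply/orP; left; apply/eqP.
    by field; lra.
  by rewrite lee_wpmul2l ?lee_fin// ggd_second_moment.
apply: ge0_le_integral => //.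
- move=> y _; rewrite lee_fin addr_ge0// mulr_ge0//.
    by rewrite mulr_ge0 ?sqr_ge0.
  by rewrite mulr_ge0 ?sqr_ge0.
- by apply/measurable_EFinP; apply: measurable_funD => //; exact: measurable_funM.
- apply/measurable_EFinP; apply: measurable_funM => //.
  apply: measurable_funM => //; apply: measurable_funD.
    exact: measurable_expRM.
  under eq_fun do rewrite -mulNr; exact: measurable_expRM.
- move=> y _; rewrite lee_fin.
  have := ler_wpM2r (g0 y) (cosh_ge (m * y)); apply: le_trans.
  by rewrite le_eqVlt; apply/orP; left; apply/eqP; field; rewrite ?gt_eqF; lra.
Qed.

(** The integral is restricted to [h/2, h], where h = (m/4)^(q-1) stands in for the maximiser
    (m/p)^(q-1) of m y - y^p. There, with a = m/4, m y - y^p >= 2 a^q - a^q; and h >= 1 bounds the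
    length below. *)
Lemma mgf_ge_powR p q c m : 2 < p -> p^-1 + q^-1 = 1 ->
  (\int[mu]_y (ggd p c y)%:E = 1)%E -> 4 <= m ->
  ((expR ((m / 4) `^ q) / gaussK)%:E <= mgf p c m)%E.
Proof.
move=> p2 pq f1 m4; have /andP[q1 q2] := conjugate_bounds p2 pq.
have c0 := ggd_const_gt0 f1; have g0 := ggd_ge0 f1.
have cK := ggd_const_ge p2 f1; have K1 := @gaussK_ge1 R.
have mg := @measurable_ggd R p c.
have p0 : 0 <= p by lra.
pose a := m / 4; pose h := a `^ (q - 1).
have a1 : 1 <= a by rewrite /a; lra.
have h1 : 1 <= h by rewrite -(powRr0 a); apply: ler_powR => //; lra.
have ha : h * a = a `^ q.
  by rewrite mulrC mulr_powRB1//; lra.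
have hp : h `^ p = a `^ q.
  rewrite -powRrM; congr (_ `^ _).
  have pn : p != 0 by lra.
  have qn : q != 0 by lra.
  have e : q + p = p * q.
    have <- : (p^-1 + q^-1) * (p * q) = p * q by rewrite pq mul1r.
    by field; rewrite pn qn.
  by rewrite mulrBl mul1r mulrC -e addrK.
have mexp : measurable_fun setT (fun y : R => expR (m * y) * ggd p c y).
  by apply: measurable_funM => //; exact: measurable_expRM.
apply: (@le_trans _ (\bar R) (\int[mu]_(y in `[(h / 2)%R, h]) (c * expR (a `^ q))%:E)%E).
  rewrite integral_cst//= lebesgue_measure_itv/= lte_fin (_ : h / 2 < h); last lra.
  rewrite -EFinD -EFinM lee_fin.
  have e1 := expR_ge1Dx (1 : R).
  rewrite -/a ler_pdivrMr; last lra.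
  have E0 := expR_gt0 (a `^ q).
  move: (expR (a `^ q)) (expR 1) E0 e1 cK => E b E0 e1 cK.
  have -> : c * E * (h - h / 2) * gaussK = E * (h / 2 * (c * gaussK)) by field.
  by rewrite ler_peMr//; [lra|nra].
apply: (@le_trans _ (\bar R) (\int[mu]_(y in `[(h / 2)%R, h]) (expR (m * y) * ggd p c y)%:E)%E).
  apply: ge0_le_integral => //.
  - by move=> y _; rewrite lee_fin mulr_ge0 ?expR_ge0// ltW.
  - by apply/measurable_EFinP; apply: measurable_funTS.
  - move=> y /=; rewrite in_itv/= => /andP[y0 y1].
    rewrite lee_fin /ggd mulrCA -expRD ler_pM2l// ler_expR.
    have h0 : 0 <= h by lra.
    have y00 : 0 <= y by rewrite (le_trans _ y0)// mulr_ge0// invr_ge0.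
    rewrite ger0_norm//.
    have yp : y `^ p <= h `^ p by apply: ge0_ler_powR; rewrite ?nnegrE.
    have my : m * (h / 2) <= m * y by rewrite ler_wpM2l//; lra.
    apply: (@le_trans _ _ (m * (h / 2) - h `^ p)); last exact: lerB.
    rewrite hp -ha {1}/a {1}/a; lra.
apply: ge0_subset_integral => //.
- exact/measurable_EFinP.
- by move=> y _; rewrite lee_fin mulr_ge0 ?expR_ge0.
Qed.

(** Up to m = 16 [gaussK] the quadratic bound 1 + t is enough, as 1 + t <= 8 [gaussK]. Beyond it,
    half of the exponent in [mgf_ge_powR] absorbs the division by [gaussK]. *)
Lemma mgf_ge p q c m : 2 < p -> p^-1 + q^-1 = 1 ->
  (\int[mu]_y (ggd p c y)%:E = 1)%E ->
  ((expR (psi q m / (512 * gaussK ^+ 2)))%:E <= mgf p c m)%E.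
Proof.
move=> p2 pq f1; have /andP[q1 q2] := conjugate_bounds p2 pq.
wlog m0 : m / 0 <= m.
  by move=> H; have := H `|m| (normr_ge0 _); rewrite /psi normr_id mgf_norm.
have K1 := @gaussK_ge1 R; set K : R := gaussK in K1 *.
have K2 : 1 <= K ^+ 2 by rewrite expr_ge1//; lra.
have [mK|mK] := leP m (16 * K).
  apply: le_trans (mgf_ge_sqr m p2 f1); rewrite -/K lee_fin.
  set t := m ^+ 2 / (64 * K).
  have t0 : 0 <= t by rewrite /t mulr_ge0 ?sqr_ge0// invr_ge0; lra.
  apply: le_trans (expR_le1D t0); rewrite ler_expR.
  have t1 : 1 + t <= 8 * K.
    rewrite /t -lerBrDl ler_pdivrMr; last lra.
    nra.
  apply: (@le_trans _ _ (t / (8 * K))); last first.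
    rewrite ler_wpM2l// lef_pV2 ?posrE; lra.
  apply: (@le_trans _ _ (m ^+ 2 / (512 * K ^+ 2))).
    rewrite ler_wpM2r//; first by rewrite invr_ge0; lra.
    by rewrite /psi ger0_norm// ge_min lexx.
  rewrite le_eqVlt; apply/orP; left; apply/eqP; rewrite /t; field; lra.
apply: le_trans (mgf_ge_powR p2 pq f1 _); last lra.
rewrite -/K lee_fin ler_pdivlMr; last lra.
set A := (m / 4) `^ q.
have A1 : m `^ q <= 16 * A.
  have -> : m `^ q = 4 `^ q * A by rewrite -powRM; [congr (_ `^ _); field|lra|lra].
  by rewrite ler_wpM2r ?powR_ge0// (le_trans (powR_le_sqr _ _))//; lra.
have A2 : m / 4 <= A by apply: le1r_powR; lra.
have e1 : K <= expR (A / 2).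
  apply: (@le_trans _ _ (2 * (A / 2))); first lra.
  by apply: expR_ge2x; lra.
have e2 : psi q m / (512 * K ^+ 2) <= A / 2.
  rewrite ler_pdivrMr; last lra.
  have : psi q m <= m `^ q by rewrite /psi ger0_norm// ge_min lexx orbT.
  nra.
apply: (@le_trans _ _ (expR (A / 2) * expR (A / 2))).
  by apply: ler_pM; rewrite ?expR_ge0 ?ler_expR//; lra.
rewrite -expRD ler_expR; lra.
Qed.

End mgf_lower_bound.

(** * Choice of the scale l for a given x *)

Section scaling.
Context {R : realType}.
Implicit Types p q m : R.

Lemma psi_double q m : q <= 2 -> psi q (2 * m) <= 4 * psi q m.
Proof.
move=> q2; rewrite /psi normrM normr_nat.
have e1 : (2 * `|m|) `^ q <= 4 * `|m| `^ q.
  by rewrite powRM// ler_wpM2r ?powR_ge0// (le_trans (powR_le_sqr _ _))//; lra.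
have e2 : (2 * `|m|) ^+ 2 = 4 * `|m| ^+ 2 by ring.
have [|] := leP (`|m| ^+ 2) (`|m| `^ q) => _; rewrite ge_min.
  by rewrite e2 lexx.
by rewrite e1 orbT.
Qed.

(** Halving replaces an intermediate value argument: the last l before the sum drops below L works,
    since one halving divides psi by at most 4. *)
Lemma scale_exists (I : finType) (x : I -> R) q (L l0 : R) :
  q <= 2 -> 0 < L -> 0 < l0 -> L <= \sum_i psi q (l0 * x i) ->
  exists l, [/\ 0 < l, l <= l0 & L <= \sum_i psi q (l * x i) <= 4 * L].
Proof.
move=> q2 L0 l00 HL.
pose F l := \sum_i psi q (l * x i).
have ex : exists k, F (l0 / 2 ^+ k) < L.
  pose Q := l0 ^+ 2 * \sum_i `|x i| ^+ 2.
  have Q0 : 0 <= Q by rewrite mulr_ge0 ?sqr_ge0// sumr_ge0.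
  have /archi_boundP := divr_ge0 Q0 (ltW L0); set k := Num.bound _ => kL.
  exists k; apply: (@le_lt_trans _ _ (Q / (2 ^+ k) ^+ 2)).
    rewrite /Q mulr_sumr mulr_suml; apply: ler_sum => i _.
    rewrite /psi ge_min; apply/orP; left.
    rewrite normrM (ger0_norm (divr_ge0 (ltW l00) _)) ?exprn_ge0//.
    by rewrite !exprMn exprVn mulrAC.
  rewrite ltr_pdivrMr ?exprn_gt0// mulrC -ltr_pdivrMr//.
  apply: (lt_le_trans kL); rewrite -exprM -natrX ler_nat.
  by rewrite (leq_trans (ltnW (ltn_expl k (isT : (1 < 2)%N))))// leq_exp2l// leq_pmulr.
case: (ex_minnP ex) => -[|k] Fk kmin.
  by move: Fk; rewrite expr0 divr1 ltNge HL.
exists (l0 / 2 ^+ k); split.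
- by rewrite divr_gt0// exprn_gt0.
- by rewrite ler_pdivrMr ?exprn_gt0// ler_peMr ?(ltW l00)// exprn_ege1// ler1n.
apply/andP; split.
  by rewrite leNgt; apply/negP => /kmin; rewrite ltnn.
apply: (@le_trans _ _ (4 * F (l0 / 2 ^+ k.+1))); last by rewrite ler_pM2l// ltW.
rewrite mulr_sumr; apply: ler_sum => i _.
apply: le_trans (psi_double _ q2); rewrite le_eqVlt; apply/orP; left.
apply/eqP; congr psi; rewrite exprS; field.
by rewrite expf_neq0.
Qed.

(** Coordinates with |x_i|^q < 1/(2n) contribute at most 1/2 to the sum; on the others psi(l0 x_i)
    >= 2 L |x_i|^q. The power branch of psi needs only 2L <= l0^q, while the square branch uses the
    lower bound on |x_i|. *)
Lemma psi_sum_ge (I : finType) (x : I -> R) p q (K L : R) :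
  let n : R := #|I|%:R in
  2 < p -> p^-1 + q^-1 = 1 -> (0 < #|I|)%N -> 1 <= K -> 0 < L -> L <= K * n ->
  1 <= \sum_i `|x i| `^ q ->
  L <= \sum_i psi q (2 * K * L `^ 2^-1 * n `^ (2^-1 - p^-1) * x i).
Proof.
move=> n p2 pq I0 K1 L0 LK x1; have /andP[q1 q2] := conjugate_bounds p2 pq.
set l0 := 2 * K * _ * _.
have n0 : 0 < n by rewrite ltr0n.
have n1 : 1 <= n by rewrite ler1n.
pose r := 1 - q / 2.
have pi0 : 0 < p^-1 by rewrite invr_gt0; lra.
have l00 : 0 <= l0 by rewrite !mulr_ge0 ?powR_ge0//; lra.
have sq : (2^-1 - p^-1) * q = r.
  have -> : p^-1 = 1 - q^-1 by lra.
  by rewrite /r; field; lra.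
have l0q : 2 * L <= l0 `^ q.
  have h0 := powR_ge0 L 2^-1; have h1 := powR_ge0 n (2^-1 - p^-1).
  rewrite powRM ?mulr_ge0//; try lra.
  rewrite powRM ?mulr_ge0//; try lra.
  rewrite -!powRrM sq (mulrC _ q).
  have Kq : 2 * K <= (2 * K) `^ q by apply: le1r_powR; lra.
  have Lr : L `^ r <= K * n `^ r.
    have Lr : L `^ r <= (K * n) `^ r.
      by apply: ge0_ler_powR => //; rewrite /r ?nnegrE; try nra; lra.
    apply: (le_trans Lr); rewrite powRM; try lra.
    by rewrite ler_wpM2r ?powR_ge0// ler1_powR// /r; lra.
  have LE : L `^ (q / 2) * L `^ r = L.
    rewrite -powRD; last by rewrite (gt_eqF L0) implybT.
    by rewrite /r addrC subrK powRr1 ?ltW.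
  have n0r := powR_ge0 n r; have L0q := powR_ge0 L (q / 2).
  apply: (@le_trans _ _ (2 * (L `^ (q / 2) * (K * n `^ r)))).
    by rewrite ler_pM2l// -{1}LE ler_wpM2l.
  rewrite (_ : 2 * _ = 2 * K * (L `^ (q / 2) * n `^ r)); last by ring.
  by rewrite -[leRHS]mulrA ler_wpM2r// mulr_ge0.
pose s2 := 2 / q - 1.
have s2E : (2^-1 - p^-1) * 2 = s2.
  have -> : p^-1 = 1 - q^-1 by lra.
  by rewrite /s2; field; lra.
have qi : 2^-1 < q^-1 < 1.
  by apply/andP; split; [rewrite ltf_pV2 ?posrE; lra|rewrite invf_lt1; lra].
have s20 : 0 <= s2 by rewrite /s2; lra.
have s21 : s2 <= 1 by rewrite /s2; lra.
have l02 : l0 ^+ 2 = 4 * K ^+ 2 * L * n `^ s2.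
  rewrite /l0 !exprMn -[(L `^ _) ^+ 2]powR_mulrn ?powR_ge0// -powRrM.
  rewrite -[(n `^ _) ^+ 2]powR_mulrn ?powR_ge0// -powRrM s2E mulVf//.
  by rewrite powRr1 ?ltW//; ring.
have main i : (2 * n)^-1 <= `|x i| `^ q -> 2 * L * `|x i| `^ q <= psi q (l0 * x i).
  set u := `|x i| `^ q => ui.
  have u0 : 0 <= u := powR_ge0 _ _.
  rewrite /psi normrM (ger0_norm l00) le_min; apply/andP; split; last first.
    by rewrite powRM// ler_wpM2r.
  have up : 0 < u by apply: lt_le_trans ui; rewrite invr_gt0; lra.
  have xp : 0 < `|x i|.
    rewrite lt0r normr_ge0 andbT; apply/eqP => x0; move: up.
    by rewrite /u x0 powR0 ?ltxx//; lra.
  (* The surplus factor u^s2 is at least n^(-s2) / 2, and l0^2 carries the compensating n^s2. *)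
  have uu : `|x i| ^+ 2 = u * u `^ s2.
    rewrite /u -powRrM -powRD; last by rewrite (gt_eqF xp) implybT.
    rewrite (_ : q + q * s2 = 2) ?powR_mulrn//.
    by rewrite /s2; field; lra.
  have w : 2^-1 <= n `^ s2 * u `^ s2.
    rewrite -powRM; [|lra|lra].
    have nu : 2^-1 <= n * u by move: ui; rewrite invfM ler_pdivrMr//; lra.
    apply: (@le_trans _ _ (2^-1 `^ s2)); first by apply: ger1_powR; lra.
    by apply: ge0_ler_powR; rewrite ?nnegrE; lra.
  rewrite exprMn uu l02.
  rewrite (_ : _ * L * _ * _ = 2 * L * u * (K ^+ 2 * (2 * (n `^ s2 * u `^ s2)))); last by ring.
  rewrite ler_peMr//; first by rewrite !mulr_ge0// ltW.
  have K2 : 1 <= K ^+ 2 by rewrite expr_ge1//; lra.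
  move: (n `^ s2 * _) w => w w2; nra.
(* After subtracting 1/(2n) the light coordinates have negative terms, so one termwise bound covers
   all coordinates. *)
apply: (@le_trans _ _ (\sum_i 2 * L * (`|x i| `^ q - (2 * n)^-1))).
  have cE : \sum_(i : I) (2 * n)^-1 = 2^-1.
    rewrite sumr_const -[LHS]mulr_natl; change (n * (2 * n)^-1 = 2^-1).
    by field; lra.
  rewrite -mulr_sumr sumrB cE.
  by move: (\sum_i _) x1 => X X1; nra.
apply: ler_sum => i _; have [ui|ui] := leP (2 * n)^-1 (`|x i| `^ q).
  apply: le_trans (main i ui); apply: ler_wpM2l; first lra.
  by rewrite gerBl invr_ge0; lra.
apply: le_trans (psi_ge0 _ _); rewrite mulr_ge0_le0//; last by rewrite subr_le0 ltW.
lra.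
Qed.

End scaling.

(** * Densities and the second moment method *)

Section second_moment.
Context d (T : measurableType d) (R : realType) (P : probability T R).
Implicit Types (Z : T -> R).

Lemma density_integral (X : T -> R) (f g : R -> R) :
  measurable_fun setT X -> measurable_fun setT f -> (forall y, 0 <= f y) ->
  has_density P X f ->
  measurable_fun setT g -> (forall y, 0 <= g y) ->
  (\int[P]_w (g (X w))%:E =
   \int[@lebesgue_measure R]_y (g y * f y)%:E)%E.
Proof.
move=> mX mf f0 Xf mg g0.
have := @eq_integral_comp_weight _ _ _ T (measurableTypeR R) (measurableTypeR R) R
  P (@lebesgue_measure R) X id (cst 1) f (EFin \o g).
move=> /(_ _ _ _ _ _ _ _ _ _)/wrap[] //.
- exact/measurable_EFinP.
- move=> A mA; rewrite preimage_id -Xf//.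
  rewrite -[LHS]/(\int[P]_(x in X @^-1` A) (cst 1%E x))%E integral_cst ?mul1e//.
  by rewrite -[_ @^-1` _]setTI; exact: mX.
move=> E; transitivity (\int[P]_x ((EFin \o g) (X x) * (cst 1 x)%:E))%E.
  by apply: eq_integral => w _; rewrite mule1.
by rewrite E.
Qed.

(** A pointwise inequality replaces Cauchy-Schwarz, so only monotonicity and linearity of the
    integral are used. The natural bound m^2 / (4B) is simplified by m >= 1. *)
Lemma paley_zygmund Z (m B : R) : measurable_fun setT Z -> (forall w, 0 <= Z w) ->
  1 <= m -> 0 < B -> (m%:E <= \int[P]_w (Z w)%:E)%E ->
  (\int[P]_w (Z w ^+ 2)%:E <= B%:E)%E ->
  ((4 * B)^-1%:E <= P [set w | m / 2 <= Z w]%R)%E.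
Proof.
move=> mZ Z0 m1 B0 mEZ EZB.
set A := [set w | _]%R.
have mA : measurable A.
  rewrite /A -[X in measurable X]setTI; apply: measurable_fun_le => //.
(* This value makes t B / 2 = m / 4, leaving m / 4 of the mean to the event. *)
pose t := m / (2 * B).
have t0 : 0 < t by rewrite divr_gt0//; lra.
have mind : measurable_fun setT (\1_A : T -> R) by exact: measurable_indic.
(* AM-GM on [A]: [Z <= (t * Z^2 + 1 / t) / 2] *)
have pt w : Z w <= m / 2 + (t / 2 * Z w ^+ 2 + (2 * t)^-1 * \1_A w).
  rewrite indicE; case: (boolP (w \in A)) => wA /=.
    have h := sqr_ge0 (t * Z w - 1); rewrite mulr1 invfM -subr_ge0.
    have -> : m / 2 + (t / 2 * Z w ^+ 2 + 2^-1 / t) - Z w =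
      m / 2 + t^-1 / 2 * (t * Z w - 1) ^+ 2 by field; rewrite gt_eqF.
    apply: addr_ge0; first lra.
    by apply: mulr_ge0 => //; apply: divr_ge0 => //; rewrite invr_ge0 ltW.
  have : Z w < m / 2.
    by rewrite ltNge; apply: contra wA => ?; apply/mem_set.
  rewrite mulr0 addr0 => h; rewrite (le_trans (ltW h))// lerDl.
  by rewrite mulr_ge0 ?sqr_ge0//; lra.
have mZ2 : measurable_fun setT (fun w => Z w ^+ 2) by exact: measurable_funX.
have Pf : P A \is a fin_num by rewrite fin_num_measure.
have t2 : 0 <= t / 2 by lra.
have it2 : 0 <= (2 * t)^-1 by rewrite invr_ge0; lra.
have m20 : 0 <= m / 2 by lra.
have H : (m%:E <= (m / 2)%:E + ((t / 2)%:E * \int[P]_w (Z w ^+ 2)%:E +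
    (2 * t)^-1%:E * P A))%E.
  have <- : (\int[P]_w (m / 2)%:E = (m / 2)%:E)%E.
    by rewrite integral_cst// [X in (_ * X)%E]probability_setT mule1.
  have <- : (\int[P]_w (\1_A w)%:E = P A)%E by rewrite integral_indic ?setIT.
  rewrite -!ge0_integralZl_EFin//; last 3 first.
  - exact/measurable_EFinP.
  - by move=> w _; rewrite lee_fin sqr_ge0.
  - exact/measurable_EFinP.
  have m2 : measurable_fun setT (fun w => (t / 2 * Z w ^+ 2)%:E).
    by apply/measurable_EFinP; apply: measurable_funM.
  have m3 : measurable_fun setT (fun w => ((2 * t)^-1 * \1_A w)%:E).
    by apply/measurable_EFinP; apply: measurable_funM.
  rewrite -ge0_integralD//; last 2 first.
  - by move=> w _; rewrite -EFinM lee_fin mulr_ge0 ?sqr_ge0.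
  - by move=> w _; rewrite -EFinM lee_fin mulr_ge0.
  rewrite -ge0_integralD//; last 2 first.
  - by move=> w _; rewrite -!EFinM -EFinD lee_fin addr_ge0// mulr_ge0 ?sqr_ge0.
  - exact: emeasurable_funD.
  apply: (le_trans mEZ); apply: ge0_le_integral => //.
  - by move=> w _; rewrite lee_fin.
  - exact/measurable_EFinP.
  - by apply: emeasurable_funD => //; exact: emeasurable_funD.
  - by move=> w _; rewrite lee_fin.
rewrite -(fineK Pf) in H *; set a := fine _ in H *.
have {}H : (m%:E <= (m / 2 + (t / 2 * B + (2 * t)^-1 * a))%:E)%E.
  apply: (le_trans H); rewrite [leRHS]EFinD leeD2l// [leRHS]EFinD -EFinM leeD2r//.
  by rewrite [leRHS]EFinM lee_wpmul2l// lee_fin.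
move: H; rewrite !lee_fin => H.
have e1 : t / 2 * B = m / 4 by rewrite /t; field; lra.
have e2 : (2 * t)^-1 = B / m.
  by rewrite /t; field; rewrite !gt_eqF//; lra.
have h : m / 4 <= B / m * a by rewrite e1 e2 in H; lra.
rewrite -[leLHS]mul1r ler_pdivrMr ?mulr_gt0//.
have : m * (m / 4) <= B * a.
  rewrite (_ : B * a = m * (B / m * a)); last by field; lra.
  by rewrite ler_pM2l//; lra.
nra.
Qed.

End second_moment.

(** * Probability that one row serves one point *)

Section row_probability.
Context {R : realType}.

(* With [scaleK * ln n <= sum psi <= 4 * scaleK * ln n], the exponents of the lower
   and upper bounds on the exponential moments are [2 * ln n] and [scaleA * ln n];
   [scaleC] makes the norm tail at most [n ^ (- scaleA) / 8]. *)
Definition scaleK : R := 1024 * gaussK ^+ 2.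
Definition scaleA : R := 256 * (1 + gaussK) * scaleK.
Definition scaleC : R := 2 * (scaleA + gaussK + 3).
Definition scale_max p (n : nat) : R :=
  2 * scaleK * (scaleK * ln n%:R) `^ 2^-1 * n%:R `^ (2^-1 - p^-1).

Lemma scaleK_ge1 : 1 <= scaleK.
Proof. by rewrite /scaleK; have := @gaussK_ge1 R; move: gaussK => K; nra. Qed.

Lemma scaleA_ge1 : 1 <= scaleA.
Proof.
have h1 := @gaussK_ge1 R; have h2 := scaleK_ge1; rewrite /scaleA.
by move: gaussK scaleK h1 h2 => K K' h1 h2; nra.
Qed.

Context d (T : measurableType d) (P : probability T R).
Variables (n : nat) (p q c : R) (Y : 'I_n -> T -> R).
Hypotheses (p2 : 2 < p) (pq : p^-1 + q^-1 = 1) (n2 : (2 <= n)%N).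
Hypotheses (mY : forall i, measurable_fun setT (Y i))
  (iY : mutually_independent P Y)
  (dY : forall i, has_density P (Y i) (ggd p c)).
Hypothesis f1 : (\int[@lebesgue_measure R]_y (ggd p c y)%:E = 1)%E.

Lemma mgf_transfer m i :
  (\int[P]_w (expR (m * Y i w))%:E = mgf p c m)%E.
Proof.
apply: (density_integral (f := ggd p c) (g := fun y => expR (m * y))) => //.
- exact: measurable_ggd.
- exact: ggd_ge0.
- exact: measurable_expRM.
Qed.

Lemma prod_mgf_le (l : R) (x : 'I_n -> R) :
  (\int[P]_w (expR (\sum_i l * x i * Y i w) ^+ 2)%:E <=
   (expR (64 * (1 + gaussK) * \sum_i psi q (l * x i)))%:E)%E.
Proof.
have E w : expR (\sum_i l * x i * Y i w) ^+ 2 =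
    \prod_i expR (2 * (l * x i) * Y i w).
  rewrite expr2 -expRD -expR_sum; congr expR.
  by rewrite -big_split; apply: eq_bigr => i _ /=; ring.
under eq_integral do rewrite E.
have le i : (mgf p c (2 * (l * x i)) <=
    (expR (64 * (1 + gaussK) * psi q (l * x i)))%:E)%E by exact: mgf_le.
have ge0 i : (0 <= mgf p c (2 * (l * x i)))%E.
  by apply: integral_ge0 => y _; rewrite lee_fin mulr_ge0 ?expR_ge0// ggd_ge0.
have := @integral_indep_prod _ T R P _ Y (fun i y => expR (2 * (l * x i) * y)) mY iY.
move=> /(_ _ _ _)/wrap[].
- by move=> i; exact: measurable_expRM.
- by move=> i y; exact: expR_ge0.
- by move=> i; rewrite mgf_transfer (le_lt_trans (le i)) ?ltry.
move=> ->; rewrite lee_fin mulr_sumr expR_sum.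
apply: ler_prod => i _; rewrite mgf_transfer fine_ge0//=.
rewrite -lee_fin fineK//.
by rewrite ge0_fin_numE// (le_lt_trans (le i)) ?ltry.
Qed.

Lemma prod_mgf_ge (l : R) (x : 'I_n -> R) :
  ((expR ((\sum_i psi q (l * x i)) / (512 * gaussK ^+ 2)))%:E <=
   \int[P]_w (expR (\sum_i l * x i * Y i w))%:E)%E.
Proof.
under eq_integral do rewrite expR_sum.
have fin i : mgf p c (l * x i) \is a fin_num.
  rewrite ge0_fin_numE; last first.
    by apply: integral_ge0 => y _; rewrite lee_fin mulr_ge0 ?expR_ge0// ggd_ge0.
  rewrite (_ : l * x i = 2 * (l * x i / 2)); last by field.
  by rewrite (le_lt_trans (mgf_le _ p2 pq f1)) ?ltry.
have := @integral_indep_prod _ T R P _ Y (fun i y => expR (l * x i * y)) mY iY.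
move=> /(_ _ _ _)/wrap[].
- by move=> i; exact: measurable_expRM.
- by move=> i y; exact: expR_ge0.
- by move=> i; rewrite mgf_transfer -ge0_fin_numE// -?mgf_transfer;
    rewrite ?mgf_transfer//; apply: integral_ge0 => y _;
    rewrite lee_fin mulr_ge0 ?expR_ge0// ggd_ge0.
move=> ->; rewrite lee_fin mulr_suml expR_sum.
apply: ler_prod => i _; rewrite expR_ge0 mgf_transfer/=.
by rewrite -lee_fin fineK//; exact: mgf_ge.
Qed.

(** Chernoff bound at parameter 1/2, where [ggd_moment_powR] is uniform in p. *)
Lemma norm_tail (C : R) :
  (P [set w | (C * n%:R <= \sum_i `|Y i w| `^ p)%R] <=
    (expR (- (C / 2 * n%:R)) * gaussK ^+ n)%:E)%E.
Proof.
set A := [set w | _].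
have mS : measurable_fun setT (fun w => \sum_i `|Y i w| `^ p).
  apply: measurable_sum => i.
  exact: (measurableT_comp (measurable_norm_powR p) (mY i)).
have mA : measurable A.
  by rewrite /A -[X in measurable X]setTI; apply: measurable_fun_le => //.
have mh : measurable_fun setT (fun y : R => expR (`|y| `^ p / 2)).
  apply: measurableT_comp => //; apply: measurable_funM => //.
  exact: measurable_norm_powR.
have tr i : (\int[P]_w (expR (`|Y i w| `^ p / 2))%:E <= gaussK%:E)%E.
  rewrite (density_integral (f := ggd p c) (g := fun y => expR (`|y| `^ p / 2)))//.
  - exact: ggd_moment_powR.
  - exact: measurable_ggd.
  - exact: ggd_ge0.
have ge0 i : (0 <= \int[P]_w (expR (`|Y i w| `^ p / 2))%:E)%E.
  by apply: integral_ge0 => y _; rewrite lee_fin expR_ge0.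
have := @integral_indep_prod _ T R P _ Y (fun i y => expR (`|y| `^ p / 2)) mY iY.
move=> /(_ _ _ _)/wrap[].
- by [].
- by move=> i y; exact: expR_ge0.
- by move=> i; rewrite (le_lt_trans (tr i)) ?ltry.
move=> E.
have EW : (\int[P]_w (expR ((\sum_i `|Y i w| `^ p) / 2))%:E <= (gaussK ^+ n)%:E)%E.
  under eq_integral do rewrite mulr_suml expR_sum.
  rewrite E lee_fin -[X in _ <= _ ^+ X]card_ord -prodr_const.
  apply: ler_prod => i _; rewrite fine_ge0//= -lee_fin fineK//.
  by rewrite ge0_fin_numE// (le_lt_trans (tr i)) ?ltry.
rewrite expRN -(@lee_pmul2l _ (expR (C / 2 * n%:R))%:E)//; last first.
  by rewrite lte_fin expR_gt0.
rewrite -EFinM mulrA divff ?mul1r ?gt_eqF ?expR_gt0//.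
apply: le_trans EW.
have <- : (\int[P]_w (\1_A w)%:E = P A)%E by rewrite integral_indic ?setIT.
rewrite -ge0_integralZl_EFin ?expR_ge0//; last first.
  exact/measurable_EFinP/measurable_indic.
apply: ge0_le_integral => //.
- apply/measurable_EFinP; apply: measurable_funM => //.
- apply/measurable_EFinP; apply: measurableT_comp => //; exact: measurable_funM.
- move=> w _; rewrite -EFinM lee_fin indicE; case: (boolP (w \in A)) => [/set_mem wA|_].
    by rewrite mulr1 ler_expR; move: wA; rewrite /A/=; lra.
  by rewrite mulr0 expR_ge0.
Qed.

(** The variable exp(l S) has mean at least n^2 and second moment at most n^[scaleA], so it reaches
    n^2 / 2 with probability at least n^(-[scaleA]) / 4. The norm tail removes at most half of
    that. *)
Lemma row_prob (x : 'I_n -> R) : 1 <= \sum_i `|x i| `^ q ->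
  ((expR (- (scaleA * ln n%:R)) / 8)%:E <=
   P [set w | (ln n%:R / scale_max p n <= \sum_i x i * Y i w)%R /\
              (\sum_i `|Y i w| `^ p <= scaleC * n%:R)%R])%E.
Proof.
move=> x1.
have K1 := @gaussK_ge1 R; have sK1 := scaleK_ge1; have sA1 := scaleA_ge1.
have n0 : 0 < n%:R :> R by rewrite ltr0n (ltn_trans _ n2).
have n2R : 2 <= n%:R :> R by rewrite ler_nat.
have lnn : ln n%:R <= n%:R - 1 :> R.
  by rewrite -[X in ln X](subrKC 1) le_ln1Dx//; lra.
have et : expR (ln n%:R) = n%:R :> R by rewrite lnK ?posrE.
have ln0 : 0 < ln n%:R :> R by rewrite ln_gt0//; lra.
set t := ln n%:R in lnn et ln0 *.
pose L := scaleK * t.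
have L0 : 0 < L by rewrite mulr_gt0//; lra.
have l00 : 0 < scale_max p n.
  rewrite /scale_max; apply: mulr_gt0; last exact: powR_gt0.
  apply: mulr_gt0; first lra.
  by apply: powR_gt0; rewrite -/t; apply: mulr_gt0; lra.
have /andP[q1 q2] := conjugate_bounds p2 pq.
have Lle : L <= \sum_i psi q (scale_max p n * x i).
  have := @psi_sum_ge R 'I_n x p q scaleK L; rewrite card_ord; apply => //.
  - by rewrite (ltn_trans _ n2).
  - by rewrite /L ler_pM2l; lra.
have [l [l0 ll0 /andP[FL FU]]] := scale_exists (ltW q2) L0 l00 Lle.
pose S w := \sum_i x i * Y i w.
have SE w : \sum_i l * x i * Y i w = l * S w.
  by rewrite mulr_sumr; apply: eq_bigr => i _; rewrite mulrA.
have mS : measurable_fun setT S.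
  by apply: measurable_sum => i; exact: measurable_funM.
have mN : measurable_fun setT (fun w => \sum_i `|Y i w| `^ p).
  apply: measurable_sum => i.
  exact: (measurableT_comp (measurable_norm_powR p) (mY i)).
have := @paley_zygmund _ T R P (fun w => expR (l * S w)) (expR (2 * t))
  (expR (scaleA * t)).
move=> /(_ _ _ _ _ _ _)/wrap[].
- by apply: measurableT_comp => //; exact: measurable_funM.
- by move=> w; exact: expR_ge0.
- by rewrite -[leLHS]expR0 ler_expR; lra.
- exact: expR_gt0.
- under eq_integral do rewrite -SE.
  apply: le_trans (prod_mgf_ge l x); rewrite lee_fin ler_expR.
  have K2 : 1 <= gaussK ^+ 2 :> R by rewrite expr_ge1//; lra.
  rewrite ler_pdivlMr; last lra.
  by apply: le_trans FL; rewrite /L /scaleK; lra.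
- under eq_integral do rewrite -SE.
  apply: (le_trans (prod_mgf_le l x)); rewrite lee_fin ler_expR.
  have -> : scaleA * t = 64 * (1 + gaussK) * (4 * L) by rewrite /scaleA /L; ring.
  by rewrite ler_wpM2l//; lra.
move=> PZ.
set B := [set w | _ /\ _].
pose B1 := [set w | t <= l * S w].
pose B2 := [set w | scaleC * n%:R <= \sum_i `|Y i w| `^ p].
have mle f g : measurable_fun setT f -> measurable_fun setT g ->
    measurable [set w : T | (f w : R) <= g w].
  by move=> mf mg; rewrite -[X in measurable X]setTI; exact: measurable_fun_le.
have mB1 : measurable B1 by apply: mle => //; exact: measurable_funM.
have mB2 : measurable B2 by exact: mle.
have mB : measurable B by apply: measurableI; exact: mle.
have BB : B1 `<=` B `|` B2.
  move=> w tS; have [h|h] := leP (scaleC * n%:R) (\sum_i `|Y i w| `^ p); first by right.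
  left; split; last exact: ltW.
  rewrite ler_pdivrMr//; apply: (le_trans tS).
  have S0 : 0 <= S w by rewrite -(pmulr_rge0 _ l0) (le_trans (ltW ln0)).
  by rewrite mulrC ler_wpM2l.
have PZ' : ((expR (- (scaleA * t)) / 4)%:E <= P B1)%E.
  rewrite expRN -invfM mulrC; apply: (le_trans PZ).
  apply: le_measure; rewrite ?inE//.
    by apply: mle => //; apply: measurableT_comp => //; exact: measurable_funM.
  move=> w /= h; rewrite /B1/= -ler_expR.
  (* n^2 / 2 >= n because n >= 2. *)
  apply: le_trans h; rewrite (_ : 2 * t = t + t); last by ring.
  by rewrite expRD et; nra.
have T2 : (P B2 <= (expR (- (scaleA * t)) / 8)%:E)%E.
  apply: (le_trans (norm_tail scaleC)); rewrite lee_fin.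
  have KE : gaussK ^+ n <= expR (gaussK * n%:R) :> R.
    rewrite mulrC expRM_natl; apply: lerXn2r; rewrite ?nnegrE ?expR_ge0//; first lra.
    by have := expR_ge1Dx (@gaussK R); lra.
  (* In [scaleC / 2], the summand [gaussK] pays for the moment factor, [scaleA] for the main term
     since ln n <= n, and 3 for exp(-3) <= 1/8. *)
  apply: (@le_trans _ _ (expR (- (scaleA * t) - 3))).
    apply: (le_trans (ler_wpM2l (expR_ge0 _) KE)).
    rewrite -expRD ler_expR /scaleC; nra.
  rewrite expRD ler_pM2l ?expR_gt0// expRN lef_pV2 ?posrE ?expR_gt0//.
  rewrite (_ : 3 = 1 + 1 + 1) ?expRD; last by ring.
  by have := expR_ge1Dx (1 : R); move: (expR 1) => e; nra.
have : (P B1 <= P B + P B2)%E.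
  apply: le_trans (measureU2 _ _ _) => //.
  by apply: le_measure; rewrite ?inE//; exact: measurableU.
have fB : P B \is a fin_num by rewrite fin_num_measure.
have fB1 : P B1 \is a fin_num by rewrite fin_num_measure.
have fB2 : P B2 \is a fin_num by rewrite fin_num_measure.
move: PZ' T2; rewrite -(fineK fB) -(fineK fB1) -(fineK fB2) -EFinD !lee_fin.
by move: (fine _) (fine _) (fine _) (expR _) => a b e r; lra.
Qed.

End row_probability.

(** * Norms, grids and the covering property *)

Section lpnorm.
Context {R : realType}.
Implicit Types (p q : R) (n : nat).

Lemma lpnorm_ge0 p n (x : 'rV[R]_n) : 0 <= lpnorm p x.
Proof. exact: powR_ge0. Qed.

Lemma lpnorm_sum_ge0 p n (x : 'rV[R]_n) : 0 <= \sum_(i < n) `|x 0 i| `^ p.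
Proof. by apply: sumr_ge0 => i _; exact: powR_ge0. Qed.

Lemma lpnormK p n (x : 'rV[R]_n) : 0 < p ->
  lpnorm p x `^ p = \sum_(i < n) `|x 0 i| `^ p.
Proof.
by move=> p0; rewrite /lpnorm -powRrM mulVf ?gt_eqF// powRr1// lpnorm_sum_ge0.
Qed.

Lemma lpnormZ p n (a : R) (x : 'rV[R]_n) : 0 < p ->
  lpnorm p (a *: x) = `|a| * lpnorm p x.
Proof.
move=> p0; rewrite /lpnorm.
under eq_bigr do rewrite mxE normrM powRM//.
rewrite -mulr_sumr powRM ?powR_ge0 ?lpnorm_sum_ge0//.
by rewrite -powRrM divff ?gt_eqF// powRr1.
Qed.

Lemma lpsphere_le1 p n (x : 'rV[R]_n) i : 0 < p -> lpsphere p x -> `|x 0 i| <= 1.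
Proof.
move=> p0 xS; have : \sum_(i < n) `|x 0 i| `^ p = 1.
  by rewrite -lpnormK// xS powR1.
rewrite (bigD1 i)//= => E.
have le1 : `|x 0 i| `^ p <= 1.
  by rewrite -E lerDl sumr_ge0// => j _; exact: powR_ge0.
rewrite leNgt; apply/negP => x1; move: le1; rewrite leNgt => /negP; apply.
have -> : 1 = 1 `^ p :> R by rewrite powR1.
by apply: gt0_ltr_powR; rewrite ?nnegrE.
Qed.

Lemma dotvZr n (a : R) (x y : 'rV[R]_n) : dotv x (a *: y) = a * dotv x y.
Proof. by rewrite /dotv mulr_sumr; apply: eq_bigr => i _; rewrite mxE mulrCA. Qed.

Lemma dotvZl n (a : R) (x y : 'rV[R]_n) : dotv (a *: x) y = a * dotv x y.
Proof. by rewrite /dotv mulr_sumr; apply: eq_bigr => i _; rewrite mxE mulrA. Qed.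

Lemma lpnormalize_sphere p n (y : 'rV[R]_n) : 0 < p ->
  lpsphere p (lpnormalize p y) <-> 0 < lpnorm p y.
Proof.
move=> p0; rewrite /lpsphere /lpnormalize /= lpnormZ//.
rewrite lt0r lpnorm_ge0 andbT ger0_norm ?invr_ge0 ?lpnorm_ge0//.
split=> [h|h]; last by rewrite mulVf.
by apply/eqP => h0; move: h; rewrite h0 mulr0 => /esym/eqP; rewrite oner_eq0.
Qed.

(** The points of [-1, 1]^n with coordinates in Z / M, shifted by M so that a finite type indexes
    them. At M = 0 division by zero leaves only the origin. *)
Definition grid n M (g : {ffun 'I_n -> 'I_(2 * M).+1}) : 'rV[R]_n :=
  \row_i (((g i)%:R - M%:R) / M%:R).

(** The least c with M |t| <= c rounds |t| upwards, and c <= M keeps the index in range for either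
    sign. *)
Lemma round_away (M : nat) (t : R) : (0 < M)%N -> `|t| <= 1 ->
  exists k : 'I_(2 * M).+1,
    `|t| <= `|(k%:R - M%:R) / M%:R| /\ `|(k%:R - M%:R) / M%:R - t| <= M%:R^-1.
Proof.
move=> M0 t1; have M0R : 0 < M%:R :> R by rewrite ltr0n.
have ex : exists c : nat, M%:R * `|t| <= c%:R.
  by exists M; rewrite ler_piMr// ltW.
case: (ex_minnP ex) => c cge cmin.
have cM : (c <= M)%N by apply: cmin; rewrite ler_piMr// ltW.
have cle : c%:R <= M%:R * `|t| + 1.
  case: c cge cmin {cM} => [|c] cge cmin.
    by rewrite addr_ge0// mulr_ge0// ltW.
  rewrite -natr1 lerD2r; rewrite leNgt; apply/negP => h.
  by have := cmin c (ltW h); rewrite ltnn.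
have c1 : `|t| <= c%:R / M%:R by rewrite ler_pdivlMr// mulrC.
have c2 : c%:R / M%:R - `|t| <= M%:R^-1.
  rewrite lerBlDr ler_pdivrMr// mulrDl mulVf ?gt_eqF//; lra.
have c0 : 0 <= c%:R / M%:R :> R by rewrite divr_ge0// ltW.
have [t0|t0] := leP 0 t.
  have kM : (M + c < (2 * M).+1)%N by rewrite ltnS mul2n -addnn leq_add2l.
  exists (Ordinal kM) => /=; rewrite natrD (addrC M%:R) addrK.
  move: c1 c2; rewrite (ger0_norm t0) => c1 c2.
  by rewrite (ger0_norm c0) ger0_norm ?subr_ge0.
have kM : (M - c < (2 * M).+1)%N.
  by rewrite ltnS (leq_trans (leq_subr _ _))// leq_pmull.
exists (Ordinal kM) => /=; rewrite natrB// addrAC subrr sub0r mulNr normrN.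
move: c1 c2; rewrite (ltr0_norm t0) => c1 c2.
rewrite (ger0_norm c0); split => //.
rewrite -normrN opprB opprK addrC ger0_norm; lra.
Qed.

Lemma grid_round n M (x : 'rV[R]_n) : (0 < M)%N -> (forall i, `|x 0 i| <= 1) ->
  exists g : {ffun 'I_n -> 'I_(2 * M).+1}, forall i,
    `|x 0 i| <= `|grid g 0 i| /\ `|grid g 0 i - x 0 i| <= M%:R^-1.
Proof.
move=> M0 x1.
have /choice[g gP] := fun i => round_away M0 (x1 i).
by exists (finfun g) => i; rewrite mxE ffunE.
Qed.

Lemma dotv_close n (x z y : 'rV[R]_n) (e : R) :
  (forall i, `|z 0 i - x 0 i| <= e) ->
  dotv z y - e * \sum_i `|y 0 i| <= dotv x y.
Proof.
move=> ze; rewrite lerBlDl -lerBlDr /dotv -sumrB mulr_sumr.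
apply: ler_sum => i _; rewrite -mulrBl (le_trans (ler_norm _))// normrM.
by rewrite ler_wpM2r.
Qed.

Lemma Tfamily_intro p q n N (tau : R) (y : 'I_N -> 'rV[R]_n) : 0 < p ->
  (forall k, 0 < lpnorm p (y k)) ->
  (forall x, lpsphere q x -> exists k, tau * lpnorm p (y k) <= dotv x (y k)) ->
  @Tfamily R p q n tau N [set lpnormalize p (y k) | k in [set: 'I_N]].
Proof.
move=> p0 y0 H; split.
- by move=> _ [k _ <-]; exact/lpnormalize_sphere.
(* An extension to [nat]; the default 0 is not taken for k < N. *)
- pose f k := if insub k is Some k' then lpnormalize p (y k') else 0.
  rewrite (_ : [set _ | _ in _] = f @` [set k | (k < N)%N]); first exact: card_image_le.
  apply/seteqP; split => _ [k kN <-].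
    by exists (val k) => /=; rewrite /f ?valK.
  by exists (Ordinal kN) => //; rewrite /f insubT.
- move=> x /H[k h]; exists (lpnormalize p (y k)); first by exists k.
  by rewrite /lpnormalize dotvZr ler_pdivlMl// mulrC.
Qed.

(* The right-hand side has countably many conditions, each measurable in [y]. *)
Lemma Tfamily_gridP p q n N (tau : R) (y : 'I_N -> 'rV[R]_n) :
  0 < p -> 0 < q -> 0 <= tau ->
  @Tfamily R p q n tau N [set lpnormalize p (y k) | k in [set: 'I_N]] <->
  (forall k, 0 < lpnorm p (y k)) /\
  (forall M (g : {ffun 'I_n -> 'I_(2 * M).+1}), 1 <= lpnorm q (grid g) ->
     exists k, tau * lpnorm p (y k) <= dotv (grid g) (y k)).
Proof.
move=> p0 q0 tau0; split.
  move=> [HS _ HT]; have yk k : 0 < lpnorm p (y k).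
    by apply/lpnormalize_sphere => //; apply: HS; exists k.
  split => // M g g1; have g0 : 0 < lpnorm q (grid g) by rewrite (lt_le_trans ltr01).
  have [|v [k _ <-]] := HT (lpnormalize q (grid g)); first exact/lpnormalize_sphere.
  rewrite /lpnormalize dotvZl dotvZr => h; exists k.
  rewrite -ler_pdivlMr// mulrC; apply: (@le_trans _ _ (lpnorm q (grid g) * tau)).
    by rewrite ler_peMl.
  by rewrite -ler_pdivlMl.
move=> [y0 H]; apply: Tfamily_intro => // x xS; apply: contrapT => nv.
have xk k : dotv x (y k) < tau * lpnorm p (y k).
  by rewrite ltNge; apply/negP => h; apply: nv; exists k.
(* If x is uncovered, every [y k] has positive slack. A mesh finer than 1 / [b k] rounds x without
   using up that slack, and M exceeds all [b k] at once. *)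
pose b k := (\sum_i `|y k 0 i|) / (tau * lpnorm p (y k) - dotv x (y k)).
have b0 k : 0 <= b k.
  by rewrite divr_ge0 ?sumr_ge0// subr_ge0 ltW.
pose M := (Num.bound (\sum_k b k)).
have /archi_boundP : 0 <= \sum_k b k by apply: sumr_ge0.
rewrite -/M => Mb.
have M0 : (0 < M)%N.
  by rewrite -(ltr0n R); apply: le_lt_trans Mb; exact: sumr_ge0.
have [g gP] := grid_round M0 (fun i => lpsphere_le1 i q0 xS).
have [|k] := H M g.
  rewrite -xS; apply: ge0_ler_powR; rewrite ?invr_ge0 ?nnegrE ?lpnorm_sum_ge0 ?(ltW q0)//.
  apply: ler_sum => i _; apply: ge0_ler_powR; rewrite ?nnegrE ?(ltW q0)//.
  by have [] := gP i.
apply/negP; rewrite -ltNge.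
have := @dotv_close n x (grid g) (y k) M%:R^-1 (fun i => (gP i).2).
rewrite lerBlDr => h; apply: (le_lt_trans h).
rewrite -ltrBrDl mulrC ltr_pdivrMr ?ltr0n// -ltr_pdivrMl ?subr_gt0//.
rewrite mulrC; apply: le_lt_trans Mb.
by rewrite (bigD1 k)//= lerDl sumr_ge0.
Qed.

End lpnorm.

Lemma scaleC_ge1 (R : realType) : 1 <= scaleC :> R.
Proof. by rewrite /scaleC; have := @gaussK_ge1 R; have := @scaleA_ge1 R; lra. Qed.

(* Unfolding these constants during unification reaches large unary numerals. *)
#[local] Opaque scaleK scaleA scaleC.

(** * From hits at grid points to inner products on the sphere *)

Section hitting.
Context {R : realType}.
Local Notation K := (@scaleK R).
Local Notation C := (@scaleC R).

(** Stated on functions, to define a subset of [vecI]. The norm bound belongs to the event because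
    the row is later normalised. *)
Definition hit p n (x f : 'I_n -> R) : Prop :=
  ln n%:R / scale_max p n <= \sum_i x i * f i /\
  \sum_i `|f i| `^ p <= scaleC * n%:R.

Definition mesh : nat := Num.bound (8 * K ^+ 2 * C).
(** The resulting tau is sqrt(ln n) / (4 K^2 C sqrt n), at most half of what a hit yields at the
    grid point; the other half pays for rounding. *)
Definition tau_const : R := 2 / (4 * K ^+ 2 * C) ^+ 2.

Lemma ln_nat_ge n : (2 <= n)%N -> 2^-1 <= ln n%:R :> R.
Proof.
move=> n2; rewrite -(expRK 2^-1) ler_ln ?posrE ?expR_gt0 ?ltr0n ?(ltn_trans _ n2)//.
apply: (@le_trans _ _ 2); last by rewrite ler_nat.
have := expR_ge1Dx (- 2^-1 : R); rewrite expRN => h.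
by rewrite -[leLHS]invrK -[leRHS]invrK lef_pV2 ?posrE ?invr_gt0 ?expR_gt0//; lra.
Qed.

Lemma norm_coord_le p n (y : 'rV[R]_n) i : 0 < p -> `|y 0 i| <= lpnorm p y.
Proof.
move=> p0; rewrite leNgt; apply/negP => h.
have : lpnorm p y `^ p < `|y 0 i| `^ p.
  by apply: gt0_ltr_powR; rewrite ?nnegrE ?lpnorm_ge0.
rewrite lpnormK// ltNge => /negP; apply.
by rewrite (bigD1 i)//= lerDl sumr_ge0// => j _; exact: powR_ge0.
Qed.

(** The dependence on p cancels: [scale_max] carries n^(1/2 - 1/p) and the norm bound n^(1/p),
    leaving sqrt n. *)
Lemma hit_dot p q n (x y : 'rV[R]_n) (g : {ffun 'I_n -> 'I_(2 * (mesh * n ^ 2)).+1}) :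
  2 < p -> p^-1 + q^-1 = 1 -> (2 <= n)%N ->
  (forall i, `|grid g 0 i - x 0 i| <= (mesh * n ^ 2)%:R^-1) ->
  hit p (grid g 0) (y 0) ->
  Num.sqrt (tau_const * ln n%:R / (2 * n%:R)) * lpnorm p y <= dotv x y.
Proof.
move=> p2 pq n2 gx [h1 h2].
have K1 := @scaleK_ge1 R; have C1 := @scaleC_ge1 R.
have n2R : 2 <= n%:R :> R by rewrite ler_nat.
have t2 := ln_nat_ge n2; set t := ln n%:R in t2 h1 *.
have n0 : 0 < n%:R :> R by lra.
have p0 : 0 < p by lra.
have mD : 8 * K ^+ 2 * C <= mesh%:R.
  have Z0 : 0 <= 8 * K ^+ 2 * C by apply: mulr_ge0; [apply: mulr_ge0|]; rewrite ?exprn_ge0//; lra.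
  by rewrite /mesh; move: (8 * _ * _) Z0 => Z Z0; apply: ltW; exact: archi_boundP.
set nr := lpnorm p y; have nr0 : 0 <= nr := lpnorm_ge0 _ _.
pose st := Num.sqrt t; pose sn := Num.sqrt (n%:R : R); pose sK := Num.sqrt K.
have st2 : st ^+ 2 = t by rewrite sqr_sqrtr//; lra.
have sn2 : sn ^+ 2 = n%:R by rewrite sqr_sqrtr// ltW.
have sK2 : sK ^+ 2 = K by rewrite sqr_sqrtr//; lra.
have st0 : 0 <= st := sqrtr_ge0 _.
have sn0 : 0 < sn by rewrite sqrtr_gt0.
have sK0 : 0 <= sK := sqrtr_ge0 _.
have sK1 : 1 <= sK by rewrite leNgt; apply/negP => h; nra.
have sn1 : 1 <= sn by rewrite leNgt; apply/negP => h; nra.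
have st1 : 2^-1 <= st by rewrite leNgt; apply/negP => h; nra.
have K20 : 0 < K ^+ 2 by apply: exprn_gt0; lra.
have Q0 : 0 < 4 * K ^+ 2 * C by apply: mulr_gt0; [apply: mulr_gt0|]; lra.
have tauE : Num.sqrt (tau_const * t / (2 * n%:R)) = st / (4 * K ^+ 2 * C * sn).
  have -> : tau_const * t / (2 * n%:R) = (st / (4 * K ^+ 2 * C * sn)) ^+ 2.
    rewrite /tau_const -st2 -sn2 expr_div_n exprMn; field.
    by rewrite !gt_eqF//; lra.
  by rewrite sqrtr_sqr ger0_norm// divr_ge0// mulr_ge0// ltW.
rewrite tauE; set tau := st / _.
have tau0 : 0 <= tau by rewrite divr_ge0// mulr_ge0// ltW.
have pinv : 0 < p^-1 < 1 by rewrite invr_gt0 invf_lt1 ?p0//=; lra.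
move/andP: pinv => [pi0 pi1].
have nrle : nr <= C * n%:R `^ p^-1.
  apply: (@le_trans _ _ ((C * n%:R) `^ p^-1)).
    rewrite /nr /lpnorm; apply: ge0_ler_powR; rewrite ?nnegrE ?lpnorm_sum_ge0 ?(ltW pi0)//.
    by rewrite mulr_ge0 ?ltW//; lra.
  rewrite powRM ?(ltW n0)//; last lra.
  by rewrite ler_wpM2r ?powR_ge0// ler1_powR// ltW.
have l0E : scale_max p n * n%:R `^ p^-1 = 2 * K * (sK * st) * sn.
  rewrite /scale_max -mulrA -powRD; last by rewrite (gt_eqF n0) implybT.
  have Kt0 : 0 <= K * t by apply: mulr_ge0; lra.
  rewrite subrK !powR12_sqrt ?(ltW n0)//.
  by rewrite sqrtrM//; lra.
have l00 : 0 < scale_max p n.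
  rewrite /scale_max; apply: mulr_gt0; last exact: powR_gt0.
  apply: mulr_gt0; first lra.
  by apply: powR_gt0; rewrite -/t; apply: mulr_gt0; lra.
have A1 : 2 * tau * nr <= dotv (grid g) y.
  apply: le_trans h1; rewrite ler_pdivlMr//.
  apply: (@le_trans _ _ (2 * tau * (C * n%:R `^ p^-1) * scale_max p n)).
    rewrite ler_wpM2r ?(ltW l00)// ler_wpM2l// mulr_ge0//.
  rewrite (_ : _ * scale_max _ _ = 2 * tau * C * (scale_max p n * n%:R `^ p^-1)); last by ring.
  rewrite l0E (_ : _ * (_ * sn) = t / sK); last first.
    rewrite /tau -st2 -sK2; field.
    by rewrite !gt_eqF//; lra.
  by rewrite ler_pdivrMr ?ler_peMr//; lra.
(* The 1-norm is bounded crudely by n times the p-norm; the n^2 in the mesh makes up for it. *)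
have A2 : (mesh * n ^ 2)%:R^-1 * \sum_i `|y 0 i| <= tau * nr.
  have S1 : \sum_i `|y 0 i| <= n%:R * nr.
    rewrite mulr_natl -[X in _ <= _ *+ X](card_ord n) -sumr_const.
    by apply: ler_sum => i _; exact: norm_coord_le.
  apply: (@le_trans _ _ ((mesh * n ^ 2)%:R^-1 * (n%:R * nr))).
    by rewrite ler_wpM2l ?invr_ge0.
  rewrite mulrA ler_wpM2r// natrM natrX.
  move: (mesh%:R : R) mD => m mD.
  have m0 : 0 < m by apply: lt_le_trans mD; apply: (lt_le_trans Q0); lra.
  rewrite (_ : _ * n%:R = (m * n%:R)^-1); last by field; rewrite !gt_eqF.
  have mn0 : 0 < m * n%:R by exact: mulr_gt0.
  have Qs0 : 0 < 4 * K ^+ 2 * C * sn by exact: mulr_gt0.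
  rewrite /tau ler_pdivlMr// ler_pdivrMl//.
  apply: (@le_trans _ _ (8 * K ^+ 2 * C * n%:R * st)); last first.
    by apply: ler_wpM2r => //; apply: ler_wpM2r => //; exact: ltW.
  rewrite (_ : 8 * _ * _ * _ * _ = 4 * K ^+ 2 * C * (2 * n%:R * st)); last by ring.
  apply: ler_wpM2l; first exact: ltW.
  by rewrite -sn2; nra.
have := @dotv_close _ n x (grid g) y _ gx; lra.
Qed.

Lemma lee_prod_ord (m : nat) (f g : 'I_m -> \bar R) :
  (forall i, (0 <= f i)%E) -> (forall i, (f i <= g i)%E) ->
  (\prod_i f i <= \prod_i g i)%E.
Proof.
move=> f0 fg; suff /andP[] : ((0 <= \prod_i f i) && (\prod_i f i <= \prod_i g i))%E by [].
elim/big_rec2 : _ => [|i y x _ /andP[y0 yx]]; first by rewrite lee_fin ler01 lexx.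
by rewrite mule_ge0//= lee_pmul.
Qed.

Section union_bound.
Context d (T : measurableType d) (P : probability T R).
Variables (N n : nat) (p q c : R) (Y : 'I_N -> 'I_n -> T -> R).
Hypotheses (p2 : 2 < p) (pq : p^-1 + q^-1 = 1) (n2 : (2 <= n)%N).
Hypotheses (mY : forall k i, measurable_fun setT (Y k i))
  (iY : mutually_independent P (fun ki : 'I_N * 'I_n => Y ki.1 ki.2))
  (dY : forall k i, has_density P (Y k i) (ggd p c)).
Hypothesis f1 : (\int[@lebesgue_measure R]_y (ggd p c y)%:E = 1)%E.

Lemma measurable_hit (x : 'I_n -> R) :
  measurable ([set f | hit p x f] : set (vecI R 'I_n)).
Proof.
have mc i := @measurable_coord R 'I_n i.
rewrite (_ : [set f | _] =
   [set f : vecI R 'I_n | (ln n%:R / scale_max p n : R) <= \sum_i x i * f i] `&`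
   [set f : vecI R 'I_n | \sum_i `|f i| `^ p <= scaleC * n%:R]); last first.
  by apply/seteqP; split.
apply: measurableI.
  rewrite -[X in measurable X]setTI; apply: measurable_fun_le => //.
  by apply: measurable_sum => i; exact: measurable_funM.
rewrite -[X in measurable X]setTI; apply: measurable_fun_le => //.
apply: measurable_sum => i.
exact: (measurableT_comp (measurable_norm_powR p) (mc i)).
Qed.

Lemma measurable_hit_row (x : 'I_n -> R) k :
  measurable [set w | hit p x (fun i => Y k i w)].
Proof.
have := measurable_tovec (mY k) measurableT (measurable_hit x).
by rewrite setTI.
Qed.

(** Independent rows each miss with probability at most 1 - r <= exp(-r), where r is the bound of
    [row_prob]. *)
Lemma no_hit_prob (x : 'I_n -> R) : 1 <= \sum_i `|x i| `^ q ->
  (P (\bigcap_(k in [set: 'I_N]) [set w | ~ hit p x (fun i => Y k i w)]) <=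
   (expR (- (expR (- (scaleA * ln n%:R)) / 8 * N%:R)))%:E)%E.
Proof.
move=> x1; set r := expR _ / 8.
have /= -> := @indep_rows _ T R 'I_n P _ Y (fun=> ~` [set f | hit p x f]) mY iY _.
  have -> : - (r * N%:R) = N%:R * - r by rewrite mulrC mulrN.
  rewrite expRM_natl -[X in _ ^+ X]card_ord -prodr_const -prodEFin.
  apply: lee_prod_ord => k; first exact: measure_ge0.
  rewrite (_ : [set w | _] = ~` [set w | hit p x (fun i => Y k i w)]) //.
  rewrite probability_setC; last exact: measurable_hit_row.
  have h : (r%:E <= P [set w | hit p x (fun i => Y k i w)])%E.
    apply: (row_prob p2 pq n2 (mY k) _ (dY k) f1 x1).
    exact: mutually_independent_row iY.
  apply: (@le_trans _ _ (1 - r%:E)%E); first exact: leeB.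
  by rewrite -EFinB lee_fin expR_ge1Dx.
by move=> k; apply: measurableC; exact: measurable_hit.
Qed.

End union_bound.
End hitting.

(** * Counting grid points against N *)

Section covering.
Context {R : realType}.

(** With D = [mesh] and n >= 2: 2 D n^2 + 1 <= 3 D n^2 <= 2^(3D) n^2 <= n^(3D + 2). *)
Definition cover_exp : nat := 3 * @mesh R + 2.

Lemma mesh_gt0 : (0 < @mesh R)%N.
Proof.
rewrite -(ltr0n R); have Z0 : 0 < 8 * scaleK ^+ 2 * scaleC :> R.
  have K1 := @scaleK_ge1 R; have C1 := @scaleC_ge1 R.
  have K2 : 0 < scaleK ^+ 2 :> R by apply: exprn_gt0; lra.
  by apply: mulr_gt0; [apply: mulr_gt0|]; lra.
rewrite /mesh; move: (8 * _ * _) Z0 => Z Z0.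
by apply: (lt_trans Z0); apply: archi_boundP; exact: ltW.
Qed.

Lemma grid_size n : (2 <= n)%N -> ((2 * (@mesh R * n ^ 2)).+1 <= n ^ cover_exp)%N.
Proof.
move=> n2; have m0 := mesh_gt0; rewrite /cover_exp; move: (@mesh R) m0 => m m0.
have n20 : (0 < n ^ 2)%N by rewrite expn_gt0 (ltn_trans _ n2).
apply: (@leq_trans (3 * m * n ^ 2)).
  by rewrite -mulnA (mulSn 2) addnC -addn1 leq_add2l muln_gt0 m0.
rewrite expnD leq_mul2r; apply/orP; right.
apply: (leq_trans (ltnW (ltn_expl (3 * m) (isT : (1 < 2)%N)))).
by rewrite leq_exp2r// muln_gt0.
Qed.

(** As 1/2 + 1/q >= 1, the exponent is at least E n ln n + ln(1/eps) with E = [cover_exp]: the first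
    term pays for at most n^(E n) grid points, the second leaves eps. *)
Lemma count_bound (q eps : R) (n N : nat) : (2 <= n)%N -> 1 < q < 2 -> 0 < eps < 1 ->
  (8 * cover_exp%:R) * n%:R `^ scaleA *
    ((2^-1 + q^-1) * n%:R * ln n%:R + ln eps^-1) <= N%:R ->
  (((2 * (@mesh R * n ^ 2)).+1 ^ n)%N%:R *
    expR (- (expR (- (scaleA * ln n%:R)) / 8 * N%:R)) <= eps :> R).
Proof.
move=> n2 /andP[q1 q2] /andP[e0 e1] HN.
have n2R : 2 <= n%:R :> R by rewrite ler_nat.
have n0 : 0 < n%:R :> R by lra.
have t2 := @ln_nat_ge R n n2.
have et : expR (ln n%:R) = n%:R :> R by rewrite lnK ?posrE.
set t := ln n%:R in t2 et HN *.
have qi : 2^-1 <= q^-1 by rewrite lef_pV2 ?posrE; lra.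
have le0 : 0 < ln eps^-1 by rewrite ln_gt0// invf_gt1.
set E := cover_exp; have E1 : 1 <= E%:R :> R by rewrite ler1n /E /cover_exp addn2.
have HN2 : E%:R * (n%:R * t + ln eps^-1) <= expR (- (scaleA * t)) / 8 * N%:R.
  have nA : n%:R `^ scaleA = expR (scaleA * t) by rewrite /powR gt_eqF.
  rewrite nA in HN.
  apply: (@le_trans _ _ (expR (- (scaleA * t)) / 8 *
      (8 * E%:R * expR (scaleA * t) * ((2^-1 + q^-1) * n%:R * t + ln eps^-1)))).
    rewrite (_ : expR _ / 8 * _ = expR (scaleA * t) * expR (- (scaleA * t)) *
      (E%:R * ((2^-1 + q^-1) * n%:R * t + ln eps^-1))); last by field; lra.
    rewrite expRxMexpNx_1 mul1r ler_wpM2l// ?ler0n// lerD2r.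
    rewrite ler_wpM2r//; first lra.
    by rewrite ler_peMl ?(ltW n0)//; lra.
  by apply: ler_wpM2l => //; rewrite divr_ge0 ?expR_ge0.
have HN3 : E%:R * n%:R * t + ln eps^-1 <= expR (- (scaleA * t)) / 8 * N%:R.
  apply: le_trans HN2; rewrite mulrDr mulrA lerD2l ler_peMl ?(ltW le0)//.
apply: (@le_trans _ _ (expR (E%:R * n%:R * t) *
    expR (- (E%:R * n%:R * t + ln eps^-1)))).
  apply: ler_pM; rewrite ?expR_ge0 ?ler0n//; last by rewrite ler_expR lerN2.
  rewrite -natrM expRM_natl et -natrX ler_nat expnM leq_exp2r ?(ltn_trans _ n2)//.
  exact: grid_size.
by rewrite -expRD opprD addrA subrr add0r expRN lnK ?posrE ?invr_gt0// invrK.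
Qed.

End covering.

(** * Union bound and the covering event *)

Lemma probability_bigsetU_le d (T : measurableType d) (R : realType)
    (P : probability T R) (I : Type) (s : seq I) (A : I -> set T) (e : R) :
  (forall i, measurable (A i)) -> (forall i, P (A i) <= e%:E)%E ->
  measurable (\big[setU/set0]_(i <- s) A i) /\
  (P (\big[setU/set0]_(i <- s) A i) <= ((size s)%:R * e)%:E)%E.
Proof.
move=> mA PA; elim: s => [|i s [mIH IH]].
  by rewrite !big_nil measure0 mul0r.
rewrite !big_cons; split; first exact: measurableU.
apply: le_trans (measureU2 _ (mA i) mIH) _; rewrite /= -natr1 mulrDl mul1r addrC EFinD.
exact: leeD.
Qed.

Section covering_event.
Context d (T : measurableType d) (R : realType) (P : probability T R).
Variables (N n : nat) (p q c : R) (Y : 'I_N -> 'I_n -> T -> R).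
Hypotheses (p2 : 2 < p) (pq : p^-1 + q^-1 = 1) (n2 : (2 <= n)%N).
Hypothesis mY : forall k i, measurable_fun setT (Y k i).

Let y k w : 'rV[R]_n := \row_i Y k i w.

Lemma measurable_lpnorm_row k : measurable_fun setT (fun w => lpnorm p (y k w)).
Proof.
apply: (measurableT_comp (measurable_powR p^-1)).
under eq_fun do under eq_bigr do rewrite mxE.
apply: measurable_sum => i.
exact: (measurableT_comp (measurable_norm_powR p) (mY k i)).
Qed.

Lemma measurable_dotv_row (x : 'rV[R]_n) k : measurable_fun setT (fun w => dotv x (y k w)).
Proof.
rewrite /dotv; under eq_fun do under eq_bigr do rewrite mxE.
by apply: measurable_sum => i; exact: measurable_funM.
Qed.

Lemma measurable_lpnorm_gt0 k : measurable [set w | 0 < lpnorm p (y k w)].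
Proof.
rewrite (_ : [set w | _] = ~` [set w | lpnorm p (y k w) <= 0]); last first.
  by apply/seteqP; split => w /=; rewrite ltNge => /negP.
apply: measurableC; rewrite -[X in measurable X]setTI.
by apply: measurable_fun_le => //; exact: measurable_lpnorm_row.
Qed.

Lemma measurable_Tfamily (tau : R) : 0 <= tau ->
  measurable [set w | @Tfamily R p q n tau N
    [set lpnormalize p (y k w) | k in [set: 'I_N]]].
Proof.
move=> tau0; have /andP[q1 q2] := conjugate_bounds p2 pq.
rewrite (_ : [set w | _] = \bigcap_(k in [set: 'I_N]) [set w | 0 < lpnorm p (y k w)] `&`
  \bigcap_(M in [set: nat]) \bigcap_(g in [set g : {ffun 'I_n -> 'I_(2 * M).+1} |
      1 <= lpnorm q (grid g)])
    \bigcup_(k in [set: 'I_N]) [set w | tau * lpnorm p (y k w) <= dotv (grid g) (y k w)]).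
  apply: measurableI.
    apply: fin_bigcap_measurable => [|k _]; first exact: finite_finset.
    exact: measurable_lpnorm_gt0.
  apply: bigcapT_measurable => M.
  apply: fin_bigcap_measurable => [|g _]; first exact: finite_finset.
  apply: fin_bigcup_measurable => [|k _]; first exact: finite_finset.
  rewrite -[X in measurable X]setTI; apply: measurable_fun_le => //.
    by apply: measurable_funM => //; exact: measurable_lpnorm_row.
  exact: measurable_dotv_row.
have p0 : 0 < p by have := p2; lra.
have q0 : 0 < q by lra.
apply/seteqP; split => w /=.
  move=> /(Tfamily_gridP _ p0 q0 tau0)[y0 H]; split; first by move=> k _; exact: y0.
  by move=> M _ g /= /H[k hk]; exists k.
move=> [y0 H]; apply/(Tfamily_gridP _ p0 q0 tau0); split; first by move=> k; exact: y0.
by move=> M g g1; have [k _ hk] := H M I g g1; exists k.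
Qed.

Hypotheses (iY : mutually_independent P (fun ki : 'I_N * 'I_n => Y ki.1 ki.2))
  (dY : forall k i, has_density P (Y k i) (ggd p c)).
Hypothesis f1 : (\int[@lebesgue_measure R]_y (ggd p c y)%:E = 1)%E.

(** A zero row normalises to 0, off the sphere, so such outcomes must be null; one coordinate with a
    density rules them out. *)
Lemma lpnorm_row_null k : P (~` [set w | 0 < lpnorm p (y k w)]) = 0%E.
Proof.
have p0 : 0 < p by have := p2; lra.
have n0 : (0 < n)%N by rewrite (ltn_trans _ n2).
pose i0 := Ordinal n0.
apply/eqP; rewrite eq_le measure_ge0 andbT.
have -> : 0%E = P (Y k i0 @^-1` [set 0]).
  rewrite dY// null_set_integral//.
  - by apply/measurable_EFinP; apply: measurable_funTS; exact: measurable_ggd.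
  - exact: lebesgue_measure_set1.
apply: le_measure; rewrite ?inE.
- by apply: measurableC; exact: measurable_lpnorm_gt0.
- by rewrite -[_ @^-1` _]setTI; exact: mY.
move=> w /= /negP; rewrite -leNgt => h.
apply/eqP; rewrite -normr_le0; apply: le_trans h.
by have := @norm_coord_le _ p n (y k w) i0 p0; rewrite mxE.
Qed.

Lemma covering_prob (eps : R) : 0 < eps < 1 ->
  (8 * (@cover_exp R)%:R) * n%:R `^ scaleA *
    ((2^-1 + q^-1) * n%:R * ln n%:R + ln eps^-1) <= N%:R ->
  ((1 - eps)%:E <= P [set w |
    @Tfamily R p q n (Num.sqrt (tau_const * ln n%:R / (2 * n%:R))) N
      [set lpnormalize p (y k w) | k in [set: 'I_N]]])%E.
Proof.
move=> eps01 HN.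
set tau := Num.sqrt _; set Good := [set w | _].
have q12 := conjugate_bounds p2 pq; have /andP[q1 q2] := q12.
have p0 : 0 < p by have := p2; lra.
have q0 : 0 < q by lra.
have mG : measurable Good by apply: measurable_Tfamily; exact: sqrtr_ge0.
pose M := (@mesh R * n ^ 2)%N.
have M0 : (0 < M)%N by rewrite muln_gt0 mesh_gt0 expn_gt0 (ltn_trans _ n2).
pose G := {ffun 'I_n -> 'I_(2 * M).+1}.
(* Grid points of q-norm below 1 get the empty event: rounding away from zero never produces
   them. *)
pose miss (g : G) := if 1 <= \sum_i `|grid g 0 i| `^ q :> R then
  \bigcap_(k in [set: 'I_N]) [set w | ~ hit p (@grid R n M g 0) (fun i => Y k i w)]
  else set0.
pose bound : R := expR (- (expR (- (scaleA * ln n%:R)) / 8 * N%:R)).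
have mmiss g : measurable (miss g).
  rewrite /miss; case: ifP => // _.
  apply: fin_bigcap_measurable => [|k _]; first exact: finite_finset.
  by apply: measurableC; exact: measurable_hit_row.
have Pmiss g : (P (miss g) <= bound%:E)%E.
  rewrite /miss; case: ifPn => [g1|_]; first exact: (no_hit_prob p2 pq n2 mY iY dY f1).
  by rewrite measure0 lee_fin expR_ge0.
have [mB PB] := @probability_bigsetU_le _ _ _ P _ (enum {: G}) miss bound mmiss Pmiss.
have [mZ PZ] := @probability_bigsetU_le _ _ _ P _ (enum 'I_N)
  (fun k => ~` [set w | 0 < lpnorm p (y k w)]) 0
  (fun k => measurableC (measurable_lpnorm_gt0 k))
  (fun k => eq_ind_r (fun z => (z <= 0%:E)%E) (lexx _) (lpnorm_row_null k)).
set B := \big[setU/set0]_(_ <- _) _ in mB PB; set Z := \big[setU/set0]_(_ <- _) _ in mZ PZ.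
have sub : ~` Good `<=` Z `|` B.
  move=> w nG; apply: contrapT => /not_orP[nZ nB]; apply: nG.
  have y0 k : 0 < lpnorm p (y k w).
    apply: contrapT => h; apply: nZ; rewrite /Z -bigcup_seq; exists k => //=.
    by rewrite mem_enum.
  apply: Tfamily_intro => // x xS.
  have [g gP] := grid_round M0 (fun i => lpsphere_le1 i q0 xS).
  have g1 : 1 <= \sum_i `|grid g 0 i| `^ q :> R.
    have <- : lpnorm q x `^ q = 1 by rewrite xS powR1.
    rewrite lpnormK//; apply: ler_sum => i _; apply: ge0_ler_powR; rewrite ?nnegrE ?(ltW q0)//.
    by have [] := gP i.
  have [k hk] : exists k, hit p (grid g 0) (fun i => Y k i w).
    apply: contrapT => /forallNP nk; apply: nB; rewrite /B -bigcup_seq; exists g => /=.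
      by rewrite mem_enum.
    by rewrite /miss g1 => k _; exact: nk.
  exists k; apply: (hit_dot p2 pq n2 (fun i => (gP i).2)).
  by rewrite (_ : y k w 0 = fun i => Y k i w)//; apply/funext => i; rewrite mxE.
have PC : (P (~` Good) <= eps%:E)%E.
  apply: (@le_trans _ _ (P Z + P B)%E).
    apply: (le_trans _ (measureU2 _ mZ mB)).
    by apply: le_measure; rewrite ?inE//; [exact: measurableC|exact: measurableU].
  have -> : eps = (size (enum 'I_N))%:R * 0 + eps by rewrite mulr0 add0r.
  rewrite EFinD; apply: leeD => //; apply: (le_trans PB); rewrite lee_fin.
  rewrite -cardE card_ffun !card_ord; exact: (count_bound n2 q12 eps01 HN).
rewrite probability_setC// in PC.
have fG : P Good \is a fin_num by rewrite fin_num_measure.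
move: PC; rewrite -(fineK fG) -EFinB !lee_fin; lra.
Qed.

End covering_event.

Theorem theorem4p11 (R : realType) :
  exists delta0 delta2 delta3 : R,
  [/\ 0 < delta0, 0 < delta2, 0 < delta3 &
  forall (p q : R) (n : nat) (eps : R),
    2 < p -> p^-1 + q^-1 = 1 -> (2 <= n)%N -> 0 < eps < 1 ->
    let N : nat :=
      `|Num.ceil (delta3 * n%:R `^ delta2 *
                 ((2^-1 + q^-1) * n%:R * ln n%:R + ln eps^-1))|%N in
    forall (d : measure_display) (T : measurableType d)
           (P : probability T R) (Y : 'I_N -> 'I_n -> {RV P >-> R}),
      (forall k i, has_density P (Y k i) (gen_gauss_density p)) ->
      mutually_independent P (fun ki : 'I_N * 'I_n => (Y ki.1 ki.2 : T -> R)) ->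
      (P [set w | @Tfamily R p q n (Num.sqrt (delta0 * ln n%:R / (2 * n%:R))) N
                    [set lpnormalize p (\row_(i < n) Y k i w) | k in [set: 'I_N]]]
        >= (1 - eps)%:E)%E].
Proof.
(* n^[scaleA] and 8 cancel the hit probability n^(-[scaleA]) / 8 of one row; [cover_exp] pays for
   the grid. *)
exists tau_const, scaleA, (8 * (@cover_exp R)%:R).
have K1 := @scaleK_ge1 R; have C1 := @scaleC_ge1 R; have A1 := @scaleA_ge1 R.
have E1 : 0 < (@cover_exp R)%:R :> R by rewrite ltr0n /cover_exp addn2.
split; [|lra|lra|].
  have K2 : 0 < scaleK ^+ 2 :> R by apply: exprn_gt0; lra.
  rewrite /tau_const; apply: divr_gt0 => //; apply: exprn_gt0.
  by apply: mulr_gt0; [apply: mulr_gt0|]; lra.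
move=> p q n eps p2 pq n2 eps01 N d T P Y dY iY.
set x := (X in Num.ceil X) in N Y dY iY *.
have xN : x <= N%:R.
  by rewrite /N natr_absz (le_trans (ceil_ge x))// ler_int ler_norm.
have x0 : 0 < x.
  have /andP[e0 e1] := eps01; have /andP[q1 q2] := conjugate_bounds p2 pq.
  have n0 : 0 < n%:R :> R by rewrite ltr0n (ltn_trans _ n2).
  have t2 := @ln_nat_ge R n n2.
  have le0 : 0 < ln eps^-1 by rewrite ln_gt0// invf_gt1.
  have qi : 0 < q^-1 by rewrite invr_gt0; lra.
  apply: mulr_gt0; first by apply: mulr_gt0; [lra|exact: powR_gt0].
  apply: addr_gt0 => //; apply: mulr_gt0; last lra.
  by apply: mulr_gt0 => //; lra.
(* At least one entry must exist: its density over the whole line gives the total mass 1 in [f1]. *)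
have N0 : (0 < N)%N by rewrite -(ltr0n R); exact: lt_le_trans xN.
clearbody N.
pose c := p / gen_gauss_const p.
have ggdE : gen_gauss_density p = ggd p c.
  by apply/funext => y; rewrite /gen_gauss_density /ggd /c mulrAC.
have f1 : (\int[@lebesgue_measure R]_y (ggd p c y)%:E = 1)%E.
  have := dY (Ordinal N0) (Ordinal (ltn_trans (ltn0Sn 0) n2)) setT measurableT.
  by rewrite preimage_setT probability_setT ggdE.
have dY' k i : has_density P (Y k i) (ggd p c) by rewrite -ggdE.
apply: (covering_prob p2 pq n2 _ iY dY' f1 eps01 xN) => //.
Qed.
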